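(* Let $N \geq 2$ be an integer, let $R > 0$ and let $\mathcal{B}_R \subset \mathbb{R}^N$ be the ball of radius $R$ centered at the origin. Let $p > 1$ and let $q: [0, R] \to \mathbb{R}$ be a continuous function such that $q(r_0) > 0$ for some $r_0 \in [0, R]$. Then, for any integer $k \geq 1$, there exists $\lambda^*(k) > 0$ such that, for every $\lambda > \lambda^*(k)$, the problem $$ \left\{ \begin{array}{ll} \displaystyle \mathrm{div} \left( \frac{\nabla u}{\sqrt{1-\vert \nabla u \vert^2}}\right) + \lambda q(\vert x \vert) \vert u \vert^{p-1} u = 0, & x \in \mathcal{B}_R, \\ u = 0, & x \in \partial \mathcal{B}_R, \end{array} \right. $$ has at least $4k$ nodal radial solutions.
   Context: A radial solution is a function of the form $u(x) = u(|x|)$ (usual abuse of notation) whose profile $u \in C^1([0,R])$ satisfies: $|u'(r)| < 1$ for every $r \in [0,R]$; the function $r \mapsto r^{N-1}\varphi(u'(r))$, with $\varphi(s) = s/\sqrt{1-s^2}$ for $s \in (-1,1)$, belongs to $C^1([0,R])$; the equation $$(r^{N-1}\varphi(u'))' + \lambda r^{N-1} q(r)|u|^{p-1}u = 0$$ holds pointwise on $[0,R]$; and $u'(0) = 0$, $u(R) = 0$. (Such a profile is automatically of class $C^2([0,R])$.) ''Nodal'' means sign-changing. *)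

(* Defs.v *)
From Stdlib Require Import Reals.
From Stdlib Require Vector.
Open Scope R_scope.

(* Points of R^N, with the Euclidean norm. *)
Definition enorm {N : nat} (x : Vector.t R N) : R :=
  sqrt (Vector.fold_right (fun t s => t ^ 2 + s) x 0).

Definition closed_ball {N : nat} (rho : R) (x : Vector.t R N) : Prop :=
  enorm x <= rho.

Definition Icc (a b r : R) : Prop := a <= r <= b.

Definition continuous_on_Icc (a b : R) (f : R -> R) : Prop :=
  forall r, Icc a b r -> continue_in f (Icc a b) r.

(* [f] is of class C^1 on [a, b] with derivative [df]; limits are taken inside
   [a, b], hence one-sided at the endpoints.  Values outside [a, b] are
   irrelevant. *)
Definition C1_on_Icc (a b : R) (f df : R -> R) : Prop :=
  (forall r, Icc a b r -> D_in f df (Icc a b) r) /\ continuous_on_Icc a b df.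

Definition phi (s : R) : R := s / sqrt (1 - s ^ 2).

(* |s|^(p-1) s.  Stdlib's [Rpower 0 y] is a nonzero junk value, but the factor
   [s] makes the product vanish at [s = 0], as it should for [p > 1]. *)
Definition signed_pow (p s : R) : R := Rpower (Rabs s) (p - 1) * s.

(* [du] is u' and [dw] is (r^(N-1) phi(u'))'; both are determined on [0, rho]
   by [u] when [0 < rho]. *)
Definition radial_profile (N : nat) (rho p : R) (q : R -> R) (lambda : R)
    (u : R -> R) : Prop :=
  exists du dw : R -> R,
    C1_on_Icc 0 rho u du /\
    (forall r, Icc 0 rho r -> Rabs (du r) < 1) /\
    C1_on_Icc 0 rho (fun r => r ^ (N - 1) * phi (du r)) dw /\
    (forall r, Icc 0 rho r ->
       dw r + lambda * r ^ (N - 1) * q r * signed_pow p (u r) = 0) /\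
    du 0 = 0 /\
    u rho = 0.

Definition radial_solution (N : nat) (rho p : R) (q : R -> R) (lambda : R)
    (U : Vector.t R N -> R) : Prop :=
  exists u : R -> R,
    radial_profile N rho p q lambda u /\
    (forall x, closed_ball rho x -> U x = u (enorm x)).

Definition nodal {N : nat} (rho : R) (U : Vector.t R N -> R) : Prop :=
  exists x y, closed_ball rho x /\ closed_ball rho y /\ U x < 0 /\ 0 < U y.

(* Main.v *)
Require Import Defs.
From Stdlib Require Import Arith Reals Lra Lia Ranalysis5 ClassicalEpsilon.
From Stdlib Require Vector.
From Coquelicot Require Import Coquelicot.
Open Scope R_scope.

(** The proof is by shooting from the center of the ball.  Write [n = N - 1] and
    let [psi] be the inverse of [phi].  A radial profile solves the first-order
    system [u' = psi (w / r ^ n)], [w' = - lambda r ^ n q |u|^(p-1) u], with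
    [u 0 = d] and [w 0 = 0].  Because [psi] is bounded by [1], every amplitude
    [d] gives a solution on the whole of [[0, rho]]; because [p > 1], the
    nonlinearity is locally Lipschitz and the solution depends continuously on
    [d] ([solution_deriv], [solution_dependence]).  It remains to choose [d] so
    that [u rho = 0].

    For [d > 0] the point [(mu u, - w)] of the phase plane never reaches the
    origin ([phase_point_nonzero]) and so has a continuous angle, starting from
    [0] at [r = 0] and depending continuously on [d] ([phase_polar],
    [angle_continuity_parameter]).  Although [q] may change sign, the axis
    [u = 0] is crossed in one direction only, since there the angular speed has
    the sign of [u' w] ([angle_stays_above]).  If the angle at [rho] is
    [(j + 1/2) pi] with [j >= 1], then [u rho = 0] and the angle has passed the
    value [pi], where [u < 0]: the solution is nodal.

    Solutions of small amplitude stay nonnegative because the nonlinearity is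
    superlinear at [0], and the one of amplitude [rho] does because [|u'| < 1];
    for both the angle at [rho] is less than [pi].  Some amplitude in between
    makes many turns when [lambda] is large.  Put [lambda = mu ^ (p + 1)]; then
    [x = mu u] and [w] satisfy [x' = mu psi (w / r ^ n)] and
    [w' = - mu r ^ n q |x|^(p-1) x], a system which moves at speed of order [mu].
    Take a point [a] in the interior with [q a > 0].  With coefficients frozen at
    [a] this is a Hamiltonian system whose nonzero orbits turn around the origin.
    By continuity in [d] one can prescribe energy [1] at [a]
    ([amplitude_with_unit_energy]).  The energy then varies little over an
    interval [[a, a + T / mu]], on which the coefficients are nearly constant as
    soon as [mu] is large, and the angle increases there by an amount
    proportional to [T] ([angle_increment]).

    The intermediate value theorem in [d], used once below and once above this
    amplitude, yields for each [j] between [1] and [k] two amplitudes with angle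
    [(j + 1/2) pi] at [rho] ([many_amplitudes]).  Together with the opposite
    solutions this makes [4 k] nodal solutions, told apart by their value at the
    center. *)

(** * One-variable calculus *)

Notation has_deriv := derivable_pt_lim.

Lemma has_deriv_ext (f g : R -> R) (x l : R) :
  (forall y, f y = g y) -> has_deriv f x l -> has_deriv g x l.
Proof.
  intros E H; apply is_derive_Reals; apply is_derive_ext with f; auto.
  now apply is_derive_Reals.
Qed.

Lemma has_deriv_eq (f : R -> R) (x l l' : R) :
  has_deriv f x l -> l = l' -> has_deriv f x l'.
Proof. now intros H <-. Qed.

Lemma has_deriv_continuity_pt (f : R -> R) (x l : R) :
  has_deriv f x l -> continuity_pt f x.
Proof. intros H; apply derivable_continuous_pt; now exists l. Qed.

Lemma nonneg_deriv_le (F f : R -> R) (a b : R) :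
  a <= b -> (forall t, a <= t <= b -> has_deriv F t (f t)) ->
  (forall t, a <= t <= b -> 0 <= f t) -> F a <= F b.
Proof.
  intros [ab| ->] HF Hf; [|lra].
  destruct (MVT_cor2 F f a b ab HF) as (x & E & Hx).
  assert (0 <= f x) by (apply Hf; lra). nra.
Qed.

Lemma deriv_bound (F f G g : R -> R) (a b : R) :
  a <= b -> (forall t, a <= t <= b -> has_deriv F t (f t)) ->
  (forall t, a <= t <= b -> has_deriv G t (g t)) ->
  (forall t, a <= t <= b -> Rabs (f t) <= g t) ->
  Rabs (F b - F a) <= G b - G a.
Proof.
  intros ab HF HG Hfg; apply Rabs_le; split.
  - enough (G a + F a <= G b + F b) by lra.
    apply (nonneg_deriv_le (fun t => G t + F t) (fun t => g t + f t)); auto.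
    + intros t Ht; apply (derivable_pt_lim_plus G F); auto.
    + intros t Ht; specialize (Hfg t Ht); apply Rabs_le_between in Hfg; lra.
  - enough (G a - F a <= G b - F b) by lra.
    apply (nonneg_deriv_le (fun t => G t - F t) (fun t => g t - f t)); auto.
    + intros t Ht; apply (derivable_pt_lim_minus G F); auto.
    + intros t Ht; specialize (Hfg t Ht); apply Rabs_le_between in Hfg; lra.
Qed.

Lemma deriv_bound_const (F f : R -> R) (B a b : R) :
  a <= b -> (forall t, a <= t <= b -> has_deriv F t (f t)) ->
  (forall t, a <= t <= b -> Rabs (f t) <= B) ->
  Rabs (F b - F a) <= B * (b - a).
Proof.
  intros ab HF Hf.
  replace (B * (b - a)) with (B * b - B * a) by ring.
  apply (deriv_bound F f (fun t => B * t) (fun _ => B)); auto.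
  intros t _; apply is_derive_Reals; auto_derive; auto; ring.
Qed.

Lemma intermediate_value (f : R -> R) (a b y : R) :
  a <= b -> (forall x, a <= x <= b -> continuity_pt f x) ->
  (f a <= y <= f b \/ f b <= y <= f a) -> exists x, a <= x <= b /\ f x = y.
Proof.
  intros ab Hf Hy.
  destruct (Req_dec (f a) y) as [|na]; [exists a; split; auto; lra|].
  destruct (Req_dec (f b) y) as [|nb]; [exists b; split; auto; lra|].
  assert (a < b).
  { destruct ab as [|E]; auto; exfalso; subst b; lra. }
  destruct Hy as [Hy|Hy].
  - destruct (IVT_interv (fun x => f x - y) a b) as (x & Hx & E); try lra.
    + intros x Hx; apply (continuity_pt_minus f (fun _ => y)); auto.
      now apply continuity_pt_const; intros ? ?.
    + exists x; split; auto; lra.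
  - destruct (IVT_interv (fun x => y - f x) a b) as (x & Hx & E); try lra.
    + intros x Hx; apply (continuity_pt_minus (fun _ => y) f); auto.
      now apply continuity_pt_const; intros ? ?.
    + exists x; split; auto; lra.
Qed.

Definition primitive (f : R -> R) (r : R) : R := RInt f 0 r.

Lemma primitive_0 (f : R -> R) : primitive f 0 = 0.
Proof. apply (RInt_point (V := R_CompleteNormedModule)). Qed.

Lemma primitive_deriv (f : R -> R) :
  continuity f -> forall r, has_deriv (primitive f) r (f r).
Proof.
  intros Hf r; apply is_derive_Reals.
  assert (Hc : forall z, continuous f z)
    by (intros z; apply continuity_pt_filterlim, Hf).
  apply (is_derive_RInt f (primitive f) 0 r); auto.
  exists (mkposreal 1 Rlt_0_1); intros y _.
  apply (RInt_correct (V := R_CompleteNormedModule)), (ex_RInt_continuous (V := R_CompleteNormedModule)); auto.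
Qed.

(** The first later point where [f] takes a value [<= c] would be a point where
    [f = c] is reached from above, which the sign of the derivative forbids. *)
Lemma stays_above (f f' : R -> R) (a b c : R) :
  a <= b -> (forall t, a <= t <= b -> has_deriv f t (f' t)) ->
  (forall t, a < t <= b -> f t = c -> 0 < f' t) ->
  c < f a -> c < f b.
Proof.
  intros ab Hf Hup Ha.
  destruct (Rlt_le_dec c (f b)) as [|Hb]; auto; exfalso.
  (* [s] is the end of the largest initial interval on which [f > c]. *)
  pose (E := fun x => a <= x <= b /\ forall t, a <= t <= x -> c < f t).
  destruct (completeness E) as (s & Hub & Hlub).
  { exists b; intros x Hx; apply Hx. }
  { exists a; split; [lra|]; intros t Ht; now replace t with a by lra. }
  assert (as_ : a <= s).
  { apply Hub; split; [lra|]; intros t Ht; now replace t with a by lra. }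
  assert (sb : s <= b) by (apply Hlub; intros x Hx; apply Hx).
  assert (Hbefore : forall t, a <= t < s -> c < f t).
  { intros t Ht.
    destruct (Rlt_le_dec c (f t)) as [|H]; auto; exfalso.
    enough (s <= t) by lra.
    apply Hlub; intros x [Hx1 Hx2].
    destruct (Rle_lt_dec x t) as [|Hlt]; auto; exfalso.
    specialize (Hx2 t ltac:(lra)); lra. }
  assert (Hcs : continuity_pt f s)
    by (apply has_deriv_continuity_pt with (f' s), Hf; lra).
  rewrite continuity_pt_locally in Hcs.
  destruct (Rtotal_order (f s) c) as [Hs|[Hs|Hs]].
  - assert (Hlt : a < s).
    { destruct (Req_dec a s) as [->|]; lra. }
    destruct (Hcs (mkposreal (c - f s) ltac:(lra))) as [h Hh]; simpl in Hh.
    pose (t := Rmax a (s - h / 2)).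
    assert (Ht : a <= t < s /\ s - h / 2 <= t).
    { unfold t; pose proof (cond_pos h); split; [split|];
      [apply Rmax_l| apply Rmax_lub_lt; lra | apply Rmax_r]. }
    specialize (Hbefore t (proj1 Ht)).
    specialize (Hh t ltac:(unfold ball; simpl; unfold AbsRing_ball, abs, minus,
      plus, opp; simpl; pose proof (cond_pos h); apply Rabs_def1; lra)).
    apply Rabs_def2 in Hh; lra.
  - assert (Hlt : a < s).
    { destruct (Req_dec a s) as [->|]; lra. }
    pose proof (Hup s ltac:(lra) Hs) as Hpos.
    destruct (Hf s ltac:(lra) (f' s) Hpos) as [h Hh].
    pose (t := Rmax a (s - h / 2)).
    assert (Ht : a <= t < s /\ s - h / 2 <= t).
    { unfold t; pose proof (cond_pos h); split; [split|];
      [apply Rmax_l| apply Rmax_lub_lt; lra | apply Rmax_r]. }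
    specialize (Hbefore t (proj1 Ht)).
    specialize (Hh (t - s) ltac:(lra)
      ltac:(pose proof (cond_pos h); apply Rabs_def1; lra)).
    replace (s + (t - s)) with t in Hh by ring.
    apply Rabs_def2 in Hh; destruct Hh as [_ Hh].
    assert (0 < (f t - f s) / (t - s)) by lra.
    assert ((f t - f s) = (f t - f s) / (t - s) * (t - s)) by (field; lra).
    nra.
  - destruct (Req_dec s b) as [->|ne]; [lra|].
    destruct (Hcs (mkposreal (f s - c) ltac:(lra))) as [h Hh]; simpl in Hh.
    pose (t := Rmin b (s + h / 2)).
    assert (Ht : s < t <= b /\ t <= s + h / 2).
    { unfold t; pose proof (cond_pos h); split; [split|];
      [apply Rmin_glb_lt; lra | apply Rmin_l | apply Rmin_r]. }
    enough (t <= s) by lra.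
    apply Hub; split; [lra|]; intros x Hx.
    destruct (Rlt_le_dec x s) as [|Hx']; [apply Hbefore; lra|].
    specialize (Hh x ltac:(unfold ball; simpl; unfold AbsRing_ball, abs, minus,
      plus, opp; simpl; pose proof (cond_pos h); apply Rabs_def1; lra)).
    apply Rabs_def2 in Hh; lra.
Qed.

Lemma gronwall (E E' : R -> R) (B a b : R) :
  a <= b -> (forall t, a <= t <= b -> has_deriv E t (E' t)) ->
  (forall t, a <= t <= b -> Rabs (E' t) <= B * E t) ->
  E a <= E b * exp (B * (b - a)) /\ E b <= E a * exp (B * (b - a)).
Proof.
  intros ab HE HB.
  assert (Hexp : forall k t, has_deriv (fun s => exp (k * (s - a))) t
    (k * exp (k * (t - a)))).
  { intros k t; apply is_derive_Reals; auto_derive; auto; unfold Rminus; ring. }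
  split.
  - replace (E a) with (E a * exp (B * (a - a)))
      by (rewrite Rminus_diag, Rmult_0_r, exp_0; ring).
    apply (nonneg_deriv_le (fun t => E t * exp (B * (t - a)))
      (fun t => E' t * exp (B * (t - a)) + E t * (B * exp (B * (t - a))))); auto.
    + intros t Ht; apply (derivable_pt_lim_mult E (fun s => exp (B * (s - a)))); auto.
    + intros t Ht; specialize (HB t Ht); apply Rabs_le_between in HB.
      pose proof (exp_pos (B * (t - a))); nra.
  - assert (H : - (E a * exp (- B * (a - a))) <= - (E b * exp (- B * (b - a)))).
    { apply (nonneg_deriv_le (fun t => - (E t * exp (- B * (t - a))))
        (fun t => - (E' t * exp (- B * (t - a)) + E t * (- B * exp (- B * (t - a))))));
        auto.
      - intros t Ht; apply (derivable_pt_lim_opp (fun t => E t * exp (- B * (t - a)))).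
        apply (derivable_pt_lim_mult E (fun s => exp (- B * (s - a)))); auto.
      - intros t Ht; specialize (HB t Ht); apply Rabs_le_between in HB.
        pose proof (exp_pos (- B * (t - a))); nra. }
    rewrite Rminus_diag, Rmult_0_r, exp_0 in H.
    replace (- B * (b - a)) with (- (B * (b - a))) in H by ring.
    rewrite exp_Ropp in H; pose proof (exp_pos (B * (b - a))) as P.
    replace (E b) with (E b * / exp (B * (b - a)) * exp (B * (b - a)))
      by (field; lra).
    apply Rmult_le_compat_r; lra.
Qed.

(** [|(x, y)|] times the sine of the angle between the vector [(x, -y)] and the
    direction [theta] is [B]; the choice of [theta'] makes [B^2 / |(x, y)|^2]
    constant, hence zero, so that [theta] is the argument of [(x, -y)]. *)
Lemma polar_angle (x y x' y' theta : R -> R) :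
  (forall r, has_deriv x r (x' r)) -> (forall r, has_deriv y r (y' r)) ->
  (forall r, 0 < x r ^ 2 + y r ^ 2) ->
  (forall r, has_deriv theta r
     ((y r * x' r - y' r * x r) / (x r ^ 2 + y r ^ 2))) ->
  0 < x 0 -> y 0 = 0 -> theta 0 = 0 ->
  forall r, exists A, 0 < A /\ x r = A * cos (theta r) /\ y r = - A * sin (theta r).
Proof.
  intros Hx Hy HE Ht x0 y0 t0.
  pose (A := fun r => x r * cos (theta r) - y r * sin (theta r)).
  pose (B := fun r => x r * sin (theta r) + y r * cos (theta r)).
  assert (Hcs : forall r, sin (theta r) ^ 2 + cos (theta r) ^ 2 = 1).
  { intros r; rewrite <- (sin2_cos2 (theta r)); unfold Rsqr; ring. }
  assert (HAB : forall r, A r ^ 2 + B r ^ 2 = x r ^ 2 + y r ^ 2).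
  { intros r; rewrite <- (Rmult_1_r (_ + y r ^ 2)), <- (Hcs r); unfold A, B; ring. }
  (* Here [B' = B * (x * x' + y * y') / (x ^ 2 + y ^ 2)]. *)
  assert (dB : forall r, has_deriv (fun s => B s ^ 2 / (x s ^ 2 + y s ^ 2)) r 0).
  { intros r; apply is_derive_Reals.
    assert (Dx := Hx r); assert (Dy := Hy r); assert (Dt := Ht r).
    apply is_derive_Reals in Dx; apply is_derive_Reals in Dy; apply is_derive_Reals in Dt.
    assert (Ex : ex_derive x r) by (now exists (x' r)).
    assert (Ey : ex_derive y r) by (now exists (y' r)).
    assert (Et : ex_derive theta r) by (eexists; eassumption).
    unfold B; auto_derive.
    - repeat split; auto; specialize (HE r); simpl in HE; simpl; lra.
    - change (Derive (fun s => x s) r) with (Derive x r).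
      change (Derive (fun s => y s) r) with (Derive y r).
      change (Derive (fun s => theta s) r) with (Derive theta r).
      rewrite (is_derive_unique _ _ _ Dx), (is_derive_unique _ _ _ Dy), (is_derive_unique _ _ _ Dt).
      specialize (HE r); field; lra. }
  assert (HB : forall r, B r = 0).
  { assert (Hc : forall s, B s ^ 2 / (x s ^ 2 + y s ^ 2) = 0).
    { assert (H0 : B 0 ^ 2 / (x 0 ^ 2 + y 0 ^ 2) = 0).
      { unfold B; rewrite t0, sin_0, y0; field; nra. }
      intros s; rewrite <- H0.
      apply Rminus_diag_uniq.
      destruct (Rle_dec 0 s) as [Hs|Hs].
      - pose proof (deriv_bound_const _ (fun _ => 0) 0 0 s Hs (fun t _ => dB t)
          (fun t _ => Req_le _ _ Rabs_R0)) as H.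
        apply Rabs_le_between in H; lra.
      - pose proof (deriv_bound_const _ (fun _ => 0) 0 s 0 ltac:(lra) (fun t _ => dB t)
          (fun t _ => Req_le _ _ Rabs_R0)) as H.
        apply Rabs_le_between in H; lra. }
    intros r; specialize (Hc r); specialize (HE r).
    assert (B r ^ 2 = 0).
    { replace (B r ^ 2) with (B r ^ 2 / (x r ^ 2 + y r ^ 2) * (x r ^ 2 + y r ^ 2))
        by (field; lra). rewrite Hc; ring. }
    nra. }
  assert (cA : continuity A).
  { intros r; apply derivable_continuous_pt.
    exists ((x' r * cos (theta r) + x r * (- sin (theta r) *
      ((y r * x' r - y' r * x r) / (x r ^ 2 + y r ^ 2))))
      - (y' r * sin (theta r) + y r * (cos (theta r) *
      ((y r * x' r - y' r * x r) / (x r ^ 2 + y r ^ 2))))).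
    apply (derivable_pt_lim_minus (fun s => x s * cos (theta s))
      (fun s => y s * sin (theta s))).
    - apply (derivable_pt_lim_mult x (fun s => cos (theta s))); auto.
      apply (derivable_pt_lim_comp theta cos); auto; apply derivable_pt_lim_cos.
    - apply (derivable_pt_lim_mult y (fun s => sin (theta s))); auto.
      apply (derivable_pt_lim_comp theta sin); auto; apply derivable_pt_lim_sin. }
  assert (A0 : 0 < A 0) by (unfold A; rewrite t0, cos_0, y0; lra).
  assert (nA : forall r, A r <> 0).
  { intros r Z; specialize (HAB r); specialize (HE r); rewrite Z, HB in HAB; nra. }
  intros r; exists (A r); split; [|split].
  - destruct (Rlt_le_dec 0 (A r)) as [|Hr]; auto; exfalso.
    destruct (Rle_dec 0 r) as [H|H].
    + destruct (intermediate_value A 0 r 0 H) as (s & _ & E); auto; [lra|].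
      now apply (nA s).
    + destruct (intermediate_value A r 0 0) as (s & _ & E); auto; try lra.
      now apply (nA s).
  - transitivity (A r * cos (theta r) + B r * sin (theta r)).
    + unfold A, B; rewrite <- (Rmult_1_r (x r)) at 1; rewrite <- (Hcs r); ring.
    + rewrite HB; ring.
  - transitivity (- A r * sin (theta r) + B r * cos (theta r)).
    + unfold A, B; rewrite <- (Rmult_1_r (y r)) at 1; rewrite <- (Hcs r); ring.
    + rewrite HB; ring.
Qed.

Lemma Rmax_0_continuity : continuity (fun r => Rmax r 0).
Proof.
  intros r e He; exists e; split; auto.
  intros y [_ Hy]; simpl in *; unfold Rdist in *.
  apply Rle_lt_trans with (Rabs (y - r)); auto.
  unfold Rmax; destruct (Rle_dec y 0), (Rle_dec r 0); unfold Rabs;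
    repeat match goal with |- context [Rcase_abs ?x] => destruct (Rcase_abs x) end; lra.
Qed.

(** The families in play (solution, momentum, velocity) are Lipschitz in the
    amplitude with a constant that grows along the radius, which is enough for
    joint continuity. *)
Lemma lipschitz_in_parameter_continuity_2d (f : R -> R -> R) (B : R -> R) (d r : R) :
  continuity_pt (f d) r -> continuity_pt B r ->
  (forall e s, Rabs (f e s - f d s) <= B s * Rabs (e - d)) ->
  continuity_2d_pt f d r.
Proof.
  intros Hf HB Hlip eps.
  rewrite continuity_pt_locally in Hf, HB.
  destruct (Hf (mkposreal (eps / 2) ltac:(pose proof (cond_pos eps); lra))) as [h1 H1].
  destruct (HB (mkposreal 1 Rlt_0_1)) as [h2 H2].
  simpl in H1, H2.
  assert (P : 0 < eps / (2 * (Rabs (B r) + 1))).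
  { pose proof (Rabs_pos (B r)); apply Rdiv_lt_0_compat; [apply cond_pos|lra]. }
  pose (h := Rmin (Rmin h1 h2) (eps / (2 * (Rabs (B r) + 1)))).
  assert (Ph : 0 < h) by (unfold h; repeat apply Rmin_glb_lt; auto; apply cond_pos).
  exists (mkposreal h Ph); simpl; intros e s He Hs.
  assert (Hh : h <= h1 /\ h <= h2 /\ h <= eps / (2 * (Rabs (B r) + 1))).
  { unfold h; pose proof (Rmin_l (Rmin h1 h2) (eps / (2 * (Rabs (B r) + 1))));
    pose proof (Rmin_r (Rmin h1 h2) (eps / (2 * (Rabs (B r) + 1))));
    pose proof (Rmin_l h1 h2); pose proof (Rmin_r h1 h2); lra. }
  specialize (H1 s ltac:(change (Rabs (s - r) < h1); lra)).
  specialize (H2 s ltac:(change (Rabs (s - r) < h2); lra)).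
  specialize (Hlip e s).
  assert (HBs : B s <= Rabs (B r) + 1).
  { pose proof (Rle_abs (B r)); apply Rabs_def2 in H2; lra. }
  assert (H3 : B s * Rabs (e - d) <= eps / 2).
  { apply Rle_trans with ((Rabs (B r) + 1) * (eps / (2 * (Rabs (B r) + 1)))).
    - pose proof (Rabs_pos (e - d)); pose proof (Rabs_pos (B r)).
      apply Rle_trans with ((Rabs (B r) + 1) * Rabs (e - d)); [nra|].
      apply Rmult_le_compat_l; lra.
    - pose proof (Rabs_pos (B r)); right; field; lra. }
  replace (f e s - f d r) with ((f e s - f d s) + (f d s - f d r)) by ring.
  apply Rle_lt_trans with (1 := Rabs_triang _ _); lra.
Qed.

Lemma continuity_2d_pt_section (f : R -> R -> R) (x y : R) :
  continuity_2d_pt f x y -> continuity_pt (f x) y.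
Proof.
  intros H; apply continuity_pt_locally; intros e; destruct (H e) as [h Hh].
  exists h; intros z Hz; apply Hh; auto.
  rewrite Rminus_diag, Rabs_R0; apply cond_pos.
Qed.

Lemma continuity_2d_pt_section_l (f : R -> R -> R) (x y : R) :
  continuity_2d_pt f x y -> continuity_pt (fun e => f e y) x.
Proof.
  intros H; apply continuity_pt_locally; intros e; destruct (H e) as [h Hh].
  exists h; intros z Hz; apply Hh; auto.
  rewrite Rminus_diag, Rabs_R0; apply cond_pos.
Qed.

Lemma lim_seq_abs_le (u : nat -> R) (l B : R) :
  is_lim_seq u l -> (forall k, Rabs (u k) <= B) -> Rabs l <= B.
Proof.
  intros Hu HB.
  apply (is_lim_seq_le (fun k => Rabs (u k)) (fun _ => B) (Rabs l) B); auto.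
  - now apply (is_lim_seq_abs u l).
  - apply is_lim_seq_const.
Qed.

Lemma cos_half_turn (j : nat) : cos (INR j * PI + PI / 2) = 0.
Proof. apply cos_eq_0_1; exists (Z.of_nat j); now rewrite <- INR_IZR_INZ. Qed.

Lemma C1_on_Icc_of_has_deriv (a b : R) (f f0 df : R -> R) :
  (forall r, Icc a b r -> f r = f0 r) ->
  (forall r, has_deriv f0 r (df r)) -> continuity df -> C1_on_Icc a b f df.
Proof.
  intros Hext Hd Hc; split.
  - intros r Hr e He; destruct (Hd r e He) as [h Hh].
    exists h; split; [apply cond_pos|].
    intros y [[Hy ny] Hyr]; simpl in *; unfold Rdist in *.
    rewrite (Hext y Hy), (Hext r Hr).
    specialize (Hh (y - r) ltac:(lra) Hyr).
    now replace (r + (y - r)) with y in Hh by ring.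
  - intros r Hr e He; destruct (Hc r e He) as (h & Hh & H).
    exists h; split; auto.
    intros y [[Hy ny] Hyr]; apply H; split; auto; split; [exact I|auto].
Qed.

(** * The power nonlinearity *)

Section Power.

Context (p : R) (p_gt1 : 1 < p).

Lemma signed_pow_0 : signed_pow p 0 = 0.
Proof. unfold signed_pow; ring. Qed.

Lemma signed_pow_scale (mu x : R) : 0 < mu ->
  signed_pow p (mu * x) = Rpower mu p * signed_pow p x.
Proof.
  intros Hmu; destruct (Req_dec x 0) as [->|nx].
  { rewrite Rmult_0_r, signed_pow_0; ring. }
  unfold signed_pow; rewrite Rabs_mult, (Rabs_right mu) by lra.
  rewrite <- Rpower_mult_distr by (auto; now apply Rabs_pos_lt).
  replace (Rpower mu p) with (Rpower mu (p - 1) * mu).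
  - ring.
  - rewrite <- (Rpower_1 mu) at 2 by auto; rewrite <- Rpower_plus.
    f_equal; ring.
Qed.

Lemma mult_signed_pow_nonneg (x : R) : 0 <= x * signed_pow p x.
Proof.
  unfold signed_pow; replace (x * (Rpower (Rabs x) (p - 1) * x))
    with (Rpower (Rabs x) (p - 1) * (x * x)) by ring.
  apply Rmult_le_pos; [left; apply exp_pos|apply Rle_0_sqr].
Qed.

Lemma mult_signed_pow_ge (x : R) : 1 <= Rabs x -> x ^ 2 <= x * signed_pow p x.
Proof.
  intros Hx; unfold signed_pow; replace (x * (Rpower (Rabs x) (p - 1) * x))
    with (Rpower (Rabs x) (p - 1) * x ^ 2) by ring.
  assert (1 <= Rpower (Rabs x) (p - 1)).
  { apply Rle_trans with (Rpower (Rabs x) 0).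
    - rewrite Rpower_O; lra.
    - apply Rle_Rpower; lra. }
  rewrite <- (Rmult_1_l (x ^ 2)) at 1.
  apply Rmult_le_compat_r; auto; apply pow2_ge_0.
Qed.

Lemma sqr_le_mult_signed_pow (x : R) : x ^ 2 <= 1 + x * signed_pow p x.
Proof.
  destruct (Rle_dec 1 (Rabs x)) as [H|H].
  - pose proof (mult_signed_pow_ge x H); lra.
  - pose proof (mult_signed_pow_nonneg x).
    assert (x ^ 2 <= 1) by (rewrite <- pow2_abs; clear - H; pose proof (Rabs_pos x); nra). lra.
Qed.

Lemma Rpower_le_1 (x e : R) : 0 <= e -> 0 < x <= 1 -> Rpower x e <= 1.
Proof.
  intros He Hx; apply Rle_trans with (Rpower 1 e); [now apply Rle_Rpower_l|].
  right; unfold Rpower; rewrite ln_1, Rmult_0_r; apply exp_0.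
Qed.

Lemma signed_pow_abs_le (x : R) : Rabs (signed_pow p x) <= 1 + x * signed_pow p x.
Proof.
  pose proof (mult_signed_pow_nonneg x) as H0.
  destruct (Req_dec x 0) as [->|nx].
  { rewrite signed_pow_0, Rabs_R0; lra. }
  pose proof (Rabs_pos_lt x nx) as Px.
  assert (E : x * signed_pow p x = Rabs x * Rabs (signed_pow p x)).
  { rewrite <- Rabs_mult; symmetry; apply Rabs_right; lra. }
  pose proof (Rabs_pos (signed_pow p x)) as Ps.
  destruct (Rle_dec 1 (Rabs x)) as [H|H]; [rewrite E; nra|].
  apply Rle_trans with 1; [|lra].
  unfold signed_pow; rewrite Rabs_mult, (Rabs_right (Rpower _ _))
    by (left; apply exp_pos).
  pose proof (Rpower_le_1 (Rabs x) (p - 1) ltac:(lra) ltac:(lra)).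
  assert (0 < Rpower (Rabs x) (p - 1)) by apply exp_pos. nra.
Qed.

Lemma signed_pow_small (eta : R) : 0 < eta -> exists delta, 0 < delta /\
  forall x, Rabs x <= delta -> Rabs (signed_pow p x) <= eta * Rabs x.
Proof.
  intros He; exists (Rpower eta (/ (p - 1))); split; [apply exp_pos|].
  intros x Hx; destruct (Req_dec x 0) as [->|nx].
  { rewrite signed_pow_0, Rabs_R0; lra. }
  unfold signed_pow; rewrite Rabs_mult, (Rabs_right (Rpower _ _))
    by (left; apply exp_pos).
  apply Rmult_le_compat_r; [apply Rabs_pos|].
  apply Rle_trans with (Rpower (Rpower eta (/ (p - 1))) (p - 1)).
  - apply Rle_Rpower_l; [lra|]; split; [now apply Rabs_pos_lt|auto].
  - rewrite Rpower_mult, Rinv_l, Rpower_1 by lra; lra.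
Qed.

(** At [0] the derivative is [0] because [p > 1].  The relation [x * l = p * ...]
    is Euler's identity for homogeneous functions; it spares a case distinction
    when differentiating [y * signed_pow p y]. *)
Lemma signed_pow_deriv (x : R) : exists l, has_deriv (signed_pow p) x l /\
  x * l = p * signed_pow p x /\
  forall M, 0 < M -> Rabs x <= M -> Rabs l <= p * Rpower M (p - 1).
Proof.
  destruct (Req_dec x 0) as [->|nx].
  - exists 0; split; [|split].
    + intros e He.
      destruct (signed_pow_small (e / 2) ltac:(lra)) as (d & Hd & H).
      exists (mkposreal d Hd); intros h nh Hh; simpl in Hh.
      rewrite Rplus_0_l, signed_pow_0, !Rminus_0_r.
      unfold Rdiv; rewrite Rabs_mult, Rabs_inv.
      pose proof (Rabs_pos_lt h nh) as Ph.
      apply Rle_lt_trans with (e / 2); [|lra].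
      apply Rmult_le_reg_r with (Rabs h); auto.
      rewrite Rmult_assoc, Rinv_l, Rmult_1_r by lra; apply H; lra.
    + rewrite signed_pow_0; ring.
    + intros M HM _; rewrite Rabs_R0; apply Rmult_le_pos; [lra|left; apply exp_pos].
  - exists (p * Rpower (Rabs x) (p - 1)); split; [|split].
    + pose proof (Rabs_pos_lt x nx) as Px.
      assert (Ha : has_deriv Rabs x (Rabs x / x)).
      { destruct (Rtotal_order x 0) as [H|[H|H]]; [|lra|].
        - rewrite (Rabs_left x H); replace (- x / x) with (-1) by (field; lra).
          now apply Rabs_derive_2.
        - rewrite (Rabs_right x) by lra; replace (x / x) with 1 by (field; lra).
          now apply Rabs_derive_1. }
      eapply has_deriv_eq.
      * apply (derivable_pt_lim_mult (fun y => Rpower (Rabs y) (p - 1)) (fun y => y)).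
        -- apply (derivable_pt_lim_comp Rabs (fun y => Rpower y (p - 1))); [exact Ha|].
           now apply derivable_pt_lim_power.
        -- apply derivable_pt_lim_id.
      * replace (Rpower (Rabs x) (p - 1))
          with (Rpower (Rabs x) (p - 1 - 1) * Rabs x).
        -- field; auto.
        -- rewrite <- (Rpower_1 (Rabs x)) at 2 by auto; rewrite <- Rpower_plus.
           f_equal; ring.
    + unfold signed_pow; ring.
    + intros M HM Hx; rewrite Rabs_mult, (Rabs_right p), (Rabs_right (Rpower _ _))
        by (try (left; apply exp_pos); lra).
      apply Rmult_le_compat_l; [lra|]; apply Rle_Rpower_l; [lra|].
      split; auto; now apply Rabs_pos_lt.
Qed.

Lemma signed_pow_primitive (x : R) :
  has_deriv (fun y => y * signed_pow p y / (p + 1)) x (signed_pow p x).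
Proof.
  destruct (signed_pow_deriv x) as (l & Hl & E & _).
  eapply has_deriv_eq.
  - apply (derivable_pt_lim_mult (fun y => y * signed_pow p y) (fun _ => / (p + 1))).
    + apply (derivable_pt_lim_mult (fun y => y) (signed_pow p)); [|exact Hl].
      apply derivable_pt_lim_id.
    + apply derivable_pt_lim_const.
  - rewrite E; field; lra.
Qed.

Lemma signed_pow_lipschitz (M x y : R) : 0 < M -> Rabs x <= M -> Rabs y <= M ->
  Rabs (signed_pow p x - signed_pow p y) <= p * Rpower M (p - 1) * Rabs (x - y).
Proof.
  intros HM; revert x y.
  assert (H : forall x y, x <= y -> Rabs x <= M -> Rabs y <= M ->
    Rabs (signed_pow p y - signed_pow p x) <= p * Rpower M (p - 1) * Rabs (y - x)).
  { intros x y xy Hx Hy; rewrite (Rabs_right (y - x)) by lra.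
    assert (HD : forall t, has_deriv (signed_pow p) t (Derive (signed_pow p) t)).
    { intros t; destruct (signed_pow_deriv t) as (l & Hl & _).
      replace (Derive (signed_pow p) t) with l; auto.
      symmetry; apply is_derive_unique; now apply is_derive_Reals. }
    apply (deriv_bound_const _ (Derive (signed_pow p))); auto.
    intros t Ht; destruct (signed_pow_deriv t) as (l & Hl & _ & Hb).
    replace (Derive (signed_pow p) t) with l.
    - apply Hb; auto; apply Rabs_le_between in Hx; apply Rabs_le_between in Hy.
      apply Rabs_le; lra.
    - symmetry; apply is_derive_unique; now apply is_derive_Reals. }
  intros x y Hx Hy; destruct (Rle_dec x y); [|apply H; auto; lra].
  rewrite Rabs_minus_sym, (Rabs_minus_sym x); auto.
Qed.

(** Cutting the nonlinearity off outside [[- M, M]] makes it globally Lipschitz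
    and bounded without changing solutions with values in [[- M, M]]. *)
Definition clamp (M x : R) : R := Rmax (- M) (Rmin M x).

Lemma clamp_abs_le (M x : R) : 0 <= M -> Rabs (clamp M x) <= M.
Proof.
  intros HM; unfold clamp; apply Rabs_le; split; [apply Rmax_l|].
  apply Rmax_lub; [lra|apply Rmin_l].
Qed.

Lemma clamp_id (M x : R) : Rabs x <= M -> clamp M x = x.
Proof.
  intros H; apply Rabs_le_between in H; unfold clamp.
  rewrite Rmin_right, Rmax_right; lra.
Qed.

Lemma clamp_lipschitz (M x y : R) : Rabs (clamp M x - clamp M y) <= Rabs (x - y).
Proof.
  unfold clamp, Rmin; destruct (Rle_dec M x), (Rle_dec M y); unfold Rmax;
    repeat match goal with |- context [Rle_dec ?a ?b] => destruct (Rle_dec a b) end;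
    unfold Rabs;
    repeat match goal with |- context [Rcase_abs ?a] => destruct (Rcase_abs a) end; lra.
Qed.

End Power.

(** * The inverse of the curvature operator *)

Definition psi (s : R) : R := s / sqrt (1 + s ^ 2).

Lemma sqrt_1_sqr_pos (s : R) : 0 < sqrt (1 + s ^ 2).
Proof. apply sqrt_lt_R0; nra. Qed.

Lemma sqrt_1_sqr_sqr (s : R) : sqrt (1 + s ^ 2) * sqrt (1 + s ^ 2) = 1 + s ^ 2.
Proof. apply sqrt_sqrt; nra. Qed.

Lemma sqrt_1_sqr_ge1 (s : R) : 1 <= sqrt (1 + s ^ 2).
Proof.
  rewrite <- sqrt_1 at 1; apply sqrt_le_1_alt; nra.
Qed.

Lemma sqrt_1_sqr_ge_abs (s : R) : Rabs s <= sqrt (1 + s ^ 2).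
Proof.
  rewrite <- sqrt_Rsqr_abs; apply sqrt_le_1_alt; unfold Rsqr; nra.
Qed.

Lemma psi_0 : psi 0 = 0.
Proof. unfold psi, Rdiv; ring. Qed.

Lemma psi_abs_lt_1 (s : R) : Rabs (psi s) < 1.
Proof.
  pose proof (sqrt_1_sqr_pos s) as P; pose proof (sqrt_1_sqr_sqr s) as Q.
  unfold psi, Rdiv; rewrite Rabs_mult, Rabs_inv, (Rabs_right (sqrt _)) by lra.
  apply Rmult_lt_reg_r with (sqrt (1 + s ^ 2)); auto.
  rewrite Rmult_assoc, Rinv_l, Rmult_1_r, Rmult_1_l by lra.
  rewrite <- sqrt_Rsqr_abs; apply sqrt_lt_1_alt; unfold Rsqr; nra.
Qed.

Lemma phi_psi (s : R) : phi (psi s) = s.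
Proof.
  pose proof (sqrt_1_sqr_pos s) as P; pose proof (sqrt_1_sqr_sqr s) as Q.
  unfold phi, psi.
  replace (1 - (s / sqrt (1 + s ^ 2)) ^ 2) with (Rsqr (/ sqrt (1 + s ^ 2))).
  - rewrite sqrt_Rsqr by (left; now apply Rinv_0_lt_compat). field; lra.
  - unfold Rsqr; apply Rmult_eq_reg_r with (sqrt (1 + s ^ 2) * sqrt (1 + s ^ 2)); [|nra].
    transitivity 1; [field; lra|].
    transitivity (sqrt (1 + s ^ 2) * sqrt (1 + s ^ 2) - s ^ 2); [lra|field; lra].
Qed.

Lemma psi_deriv (s : R) : has_deriv psi s (/ ((1 + s ^ 2) * sqrt (1 + s ^ 2))).
Proof.
  pose proof (sqrt_1_sqr_pos s) as P; pose proof (sqrt_1_sqr_sqr s) as Q.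
  apply is_derive_Reals; unfold psi; auto_derive.
  - replace (s * (s * 1)) with (s ^ 2) by ring. repeat split; nra.
  - replace (s * (s * 1)) with (s ^ 2) by ring.
    set (S := sqrt (1 + s ^ 2)) in *.
    replace (1 + s ^ 2) with (S * S) by exact Q.
    transitivity ((S * S - s ^ 2) / (S * S * S)); [field; lra|].
    replace (S * S - s ^ 2) with 1 by lra; field; lra.
Qed.

Lemma psi_continuity : continuity psi.
Proof. intros s; eapply has_deriv_continuity_pt, psi_deriv. Qed.

Lemma psi_lipschitz (x y : R) : Rabs (psi x - psi y) <= Rabs (x - y).
Proof.
  assert (H : forall a b, a <= b -> Rabs (psi b - psi a) <= Rabs (b - a)).
  { intros a b ab; rewrite (Rabs_right (b - a)) by lra.
    rewrite <- (Rmult_1_l (b - a)).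
    apply (deriv_bound_const _ _ 1 a b ab (fun t _ => psi_deriv t)).
    intros t _.
    pose proof (sqrt_1_sqr_ge1 t) as P.
    assert (1 <= (1 + t ^ 2) * sqrt (1 + t ^ 2)) by (pose proof (pow2_ge_0 t); nra).
    rewrite Rabs_right.
    - apply Rle_trans with (/ 1); [apply Rinv_le_contravar|]; lra.
    - left; apply Rinv_0_lt_compat; lra. }
  destruct (Rle_dec x y); [|apply H; lra].
  rewrite Rabs_minus_sym, (Rabs_minus_sym x); auto.
Qed.

Lemma mult_psi_pos (x : R) : x <> 0 -> 0 < x * psi x.
Proof.
  intros nx; unfold psi.
  replace (x * (x / sqrt (1 + x ^ 2))) with (x ^ 2 * / sqrt (1 + x ^ 2))
    by (unfold Rdiv; ring).
  apply Rmult_lt_0_compat; [nra|apply Rinv_0_lt_compat, sqrt_1_sqr_pos].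
Qed.

Lemma psi_abs_le (x : R) : Rabs (psi x) <= Rabs x.
Proof.
  pose proof (psi_lipschitz x 0) as H; now rewrite psi_0, !Rminus_0_r in H.
Qed.

(** The part of the Hamiltonian that depends on the momentum when the weight is
    the constant [alpha]. *)
Definition kinetic (alpha w : R) : R := alpha * (sqrt (1 + (w / alpha) ^ 2) - 1).

Lemma kinetic_deriv (alpha w : R) : 0 < alpha ->
  has_deriv (kinetic alpha) w (psi (w / alpha)).
Proof.
  intros Ha; apply is_derive_Reals; unfold kinetic, psi; auto_derive.
  - pose proof (pow2_ge_0 (w / alpha)); unfold Rdiv in *; simpl in *; lra.
  - replace (w * / alpha * (w * / alpha * 1)) with ((w / alpha) ^ 2)
      by (unfold Rdiv; ring).
    pose proof (sqrt_1_sqr_pos (w / alpha)); field; lra.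
Qed.

Lemma kinetic_nonneg (alpha w : R) : 0 < alpha -> 0 <= kinetic alpha w.
Proof.
  intros Ha; pose proof (sqrt_1_sqr_ge1 (w / alpha)).
  apply Rmult_le_pos; lra.
Qed.

Lemma kinetic_le (alpha w : R) : 0 < alpha ->
  kinetic alpha w <= w * psi (w / alpha).
Proof.
  intros Ha; unfold kinetic, psi.
  set (x := w / alpha); replace w with (alpha * x) by (unfold x; field; lra).
  rewrite Rmult_assoc; apply Rmult_le_compat_l; [lra|].
  pose proof (sqrt_1_sqr_ge1 x) as H1; pose proof (sqrt_1_sqr_sqr x) as H2.
  set (S := sqrt (1 + x ^ 2)) in *.
  apply Rmult_le_reg_r with S; [lra|].
  replace (x * (x / S) * S) with (x ^ 2) by (field; lra).
  clear - H1 H2; nra.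
Qed.

Lemma momentum_le_kinetic (alpha w : R) : 0 < alpha ->
  Rabs w <= alpha + kinetic alpha w.
Proof.
  intros Ha; unfold kinetic.
  pose proof (sqrt_1_sqr_ge_abs (w / alpha)) as H.
  replace (Rabs w) with (alpha * Rabs (w / alpha)); [nra|].
  rewrite <- (Rabs_right alpha) at 1 by lra.
  rewrite <- Rabs_mult; f_equal; field; lra.
Qed.

Lemma sqrt_1_sqr_mono (x k : R) : 1 <= k -> sqrt (1 + x ^ 2) <= sqrt (1 + (k * x) ^ 2).
Proof.
  intros Hk; apply sqrt_le_1_alt.
  replace ((k * x) ^ 2) with (k ^ 2 * x ^ 2) by ring.
  assert (1 <= k ^ 2) by (clear - Hk; nra).
  rewrite <- (Rmult_1_l (x ^ 2)) at 1.
  apply Rplus_le_compat_l, Rmult_le_compat_r; auto; apply pow2_ge_0.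
Qed.

Lemma mult_psi_scale (x k : R) : 1 <= k -> x * psi (k * x) <= k * (x * psi x).
Proof.
  intros Hk; unfold psi.
  pose proof (sqrt_1_sqr_pos x); pose proof (sqrt_1_sqr_mono x k Hk) as H1.
  replace (x * (k * x / sqrt (1 + (k * x) ^ 2)))
    with (k * x ^ 2 * / sqrt (1 + (k * x) ^ 2)) by (unfold Rdiv; ring).
  replace (k * (x * (x / sqrt (1 + x ^ 2))))
    with (k * x ^ 2 * / sqrt (1 + x ^ 2)) by (unfold Rdiv; ring).
  apply Rmult_le_compat_l; [pose proof (pow2_ge_0 x); nra|].
  now apply Rinv_le_contravar.
Qed.

(** For [x >= 0] concavity gives [psi (k * x) <= k * psi x], so the gap is at most
    [(k - 1) * psi x]; the bound is uniform in [x], which makes a small relative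
    change of the weight harmless even for large momenta. *)
Lemma psi_scale_close (x k : R) : 1 <= k -> Rabs (psi x - psi (k * x)) <= k - 1.
Proof.
  intros Hk.
  assert (H : forall x, 0 <= x -> Rabs (psi x - psi (k * x)) <= k - 1).
  { intros y Hy; destruct (Req_dec y 0) as [->|ny].
    { rewrite Rmult_0_r, Rminus_diag, Rabs_R0; lra. }
    assert (H1 : psi (k * y) <= k * psi y).
    { apply Rmult_le_reg_l with y; [lra|].
      pose proof (mult_psi_scale y k Hk); lra. }
    assert (H2 : psi y <= psi (k * y)).
    { apply (nonneg_deriv_le psi _ y (k * y)) with (2 := fun t _ => psi_deriv t); [nra|].
      intros t _; left; apply Rinv_0_lt_compat.
      apply Rmult_lt_0_compat; [pose proof (pow2_ge_0 t); lra|apply sqrt_1_sqr_pos]. }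
    pose proof (psi_abs_lt_1 y) as H3; apply Rabs_def2 in H3.
    assert (0 < psi y) by (pose proof (mult_psi_pos y ny); nra).
    apply Rabs_le; nra. }
  assert (psi_opp : forall y, psi (- y) = - psi y).
  { intros y; unfold psi; replace ((- y) ^ 2) with (y ^ 2) by ring.
    unfold Rdiv; ring. }
  destruct (Rle_dec 0 x) as [Hx|Hx]; auto.
  specialize (H (- x) ltac:(lra)).
  replace (k * - x) with (- (k * x)) in H by ring; rewrite !psi_opp in H.
  rewrite <- Rabs_Ropp; replace (- (psi x - psi (k * x)))
    with (- psi x - - psi (k * x)) by ring; exact H.
Qed.

(** * The radial initial value problem *)

(** The momentum is [w = r ^ n * phi u'].  A solution is a fixed point of the
    integrated system; it exists globally because [psi] is bounded.  For the
    contraction argument the nonlinear term [c r * g u] is globally Lipschitz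
    in [u]. *)

Section RadialIVP.

Context (n : nat) (n_pos : (1 <= n)%nat).
Context (c g : R -> R) (C G L K : R).
Context (c_cont : continuity c) (c_bound : forall r, Rabs (c r) <= C).
Context (g_lip : forall x y, Rabs (g x - g y) <= L * Rabs (x - y))
  (g_0 : g 0 = 0) (g_bound : forall x, Rabs (g x) <= G).
Context (K_ge1 : 1 <= K) (K_large : 2 * (C * L) <= K ^ 2).

(** Cut off at [0] so that every function below is defined and continuous on the
    whole line, solutions being constant to the left of [0]. *)
Definition weight (r : R) : R := Rmax r 0 ^ n.

Definition source (v : R -> R) (t : R) : R := weight t * (c t * g (v t)).

Definition momentum (v : R -> R) (r : R) : R := - primitive (source v) r.

(** To the left of [0], and at [0], the momentum vanishes, so that the quotient is
    [0] there whatever the value of [/ 0]. *)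
Definition slope (v : R -> R) (r : R) : R := momentum v r / weight r.

Definition velocity (v : R -> R) (r : R) : R := psi (slope v r).

Definition picard (d : R) (v : R -> R) (r : R) : R := d + primitive (velocity v) r.

Lemma C_nonneg : 0 <= C.
Proof. pose proof (c_bound 0); pose proof (Rabs_pos (c 0)); lra. Qed.

Lemma G_nonneg : 0 <= G.
Proof. pose proof (g_bound 0); pose proof (Rabs_pos (g 0)); lra. Qed.

Lemma L_nonneg : 0 <= L.
Proof.
  pose proof (g_lip 1 0) as H; pose proof (Rabs_pos (g 1 - g 0)).
  rewrite Rminus_0_r, Rabs_R1 in H; lra.
Qed.

Lemma weight_nonneg (r : R) : 0 <= weight r.
Proof. apply pow_le, Rmax_r. Qed.

Lemma weight_nonpos (r : R) : r <= 0 -> weight r = 0.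
Proof. intros H; unfold weight; rewrite Rmax_right by auto; apply pow_i; lia. Qed.

Lemma weight_eq (r : R) : 0 <= r -> weight r = r ^ n.
Proof. intros H; unfold weight; now rewrite Rmax_left. Qed.

Lemma weight_pos (r : R) : 0 < r -> 0 < weight r.
Proof. intros H; rewrite weight_eq by lra; now apply pow_lt. Qed.

Lemma weight_le (s r : R) : s <= r -> weight s <= weight r.
Proof.
  intros H; apply pow_incr; split; [apply Rmax_r|].
  apply Rmax_lub; [|apply Rmax_r]. apply Rle_trans with r; auto; apply Rmax_l.
Qed.

Lemma weight_continuity : continuity weight.
Proof.
  unfold weight; intros r.
  apply (continuity_pt_comp (fun s => Rmax s 0) (fun s => s ^ n)).
  - apply Rmax_0_continuity.
  - apply derivable_continuous_pt; exists (INR n * Rmax r 0 ^ pred n).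
    apply derivable_pt_lim_pow.
Qed.

Lemma g_continuity : continuity g.
Proof.
  pose proof L_nonneg as HL.
  intros x e He; exists (e / (L + 1)); split.
  { apply Rdiv_lt_0_compat; lra. }
  intros y [_ Hy]; simpl in *; unfold Rdist in *.
  apply Rle_lt_trans with (1 := g_lip y x).
  apply Rle_lt_trans with ((L + 1) * Rabs (y - x)).
  - pose proof (Rabs_pos (y - x)); nra.
  - apply Rmult_lt_reg_r with (/ (L + 1)); [apply Rinv_0_lt_compat; lra|].
    replace ((L + 1) * Rabs (y - x) * / (L + 1)) with (Rabs (y - x)) by (field; lra).
    exact Hy.
Qed.

Lemma source_continuity (v : R -> R) : continuity v -> continuity (source v).
Proof.
  intros Hv; apply (continuity_mult weight (fun t => c t * g (v t))).
  - apply weight_continuity.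
  - apply (continuity_mult c (fun t => g (v t))); auto.
    apply (continuity_comp v g); auto; apply g_continuity.
Qed.

Lemma momentum_deriv (v : R -> R) (r : R) :
  continuity v -> has_deriv (momentum v) r (- source v r).
Proof.
  intros Hv; apply (derivable_pt_lim_opp (primitive (source v))).
  now apply primitive_deriv, source_continuity.
Qed.

Lemma momentum_0 (v : R -> R) : momentum v 0 = 0.
Proof. unfold momentum; rewrite primitive_0; ring. Qed.

Lemma momentum_nonpos (v : R -> R) (r : R) :
  continuity v -> r <= 0 -> momentum v r = 0.
Proof.
  intros Hv Hr.
  assert (H : Rabs (momentum v 0 - momentum v r) <= 0 * (0 - r)).
  { apply (deriv_bound_const _ (fun t => - source v t)); auto.
    - intros t Ht; now apply momentum_deriv.
    - intros t Ht; unfold source; rewrite weight_nonpos by lra.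
      rewrite Rmult_0_l, Ropp_0, Rabs_R0; lra. }
  rewrite momentum_0 in H; apply Rabs_le_between in H; lra.
Qed.

Lemma slope_nonpos (v : R -> R) (r : R) :
  continuity v -> r <= 0 -> slope v r = 0.
Proof.
  intros Hv Hr; unfold slope; rewrite momentum_nonpos by auto; unfold Rdiv; ring.
Qed.

(** Since the weight is nondecreasing, a bound on the nonlinear term over
    [[0, r]] gives a bound on the averaged slope with no singular factor. *)
Lemma momentum_bound (v : R -> R) (B r : R) :
  continuity v -> 0 <= r ->
  (forall t, 0 <= t <= r -> Rabs (c t * g (v t)) <= B) ->
  Rabs (momentum v r) <= weight r * B * r.
Proof.
  intros Hv Hr HB.
  rewrite <- (Rminus_0_r (momentum v r)), <- (momentum_0 v).
  replace (weight r * B * r) with (weight r * B * (r - 0)) by ring.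
  apply (deriv_bound_const _ (fun t => - source v t)); auto.
  - intros t Ht; now apply momentum_deriv.
  - intros t Ht; unfold source; rewrite Rabs_Ropp, Rabs_mult.
    rewrite (Rabs_right (weight t)) by (apply Rle_ge, weight_nonneg).
    apply Rmult_le_compat; auto using weight_nonneg, Rabs_pos.
    apply weight_le; lra.
Qed.

Lemma slope_bound (v : R -> R) (B r : R) :
  continuity v -> 0 <= r ->
  (forall t, 0 <= t <= r -> Rabs (c t * g (v t)) <= B) ->
  Rabs (slope v r) <= B * r.
Proof.
  intros Hv Hr HB.
  destruct (Req_dec r 0) as [->|nr].
  { rewrite slope_nonpos, Rabs_R0 by (auto; lra); lra. }
  pose proof (weight_pos r ltac:(lra)) as W.
  unfold slope, Rdiv; rewrite Rabs_mult, (Rabs_right (/ _)).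
  2: { left; now apply Rinv_0_lt_compat. }
  apply Rmult_le_reg_r with (weight r); auto.
  rewrite Rmult_assoc, Rinv_l, Rmult_1_r by lra.
  apply Rle_trans with (1 := momentum_bound v B r Hv Hr HB); lra.
Qed.

Lemma nonlinearity_bound (v : R -> R) (t : R) : Rabs (c t * g (v t)) <= C * G.
Proof. rewrite Rabs_mult; apply Rmult_le_compat; auto using Rabs_pos. Qed.

Lemma slope_continuity (v : R -> R) : continuity v -> continuity (slope v).
Proof.
  intros Hv r.
  destruct (Rlt_le_dec 0 r) as [Hr|Hr].
  - apply (continuity_pt_div (momentum v) weight).
    + eapply has_deriv_continuity_pt, momentum_deriv; auto.
    + apply weight_continuity.
    + pose proof (weight_pos r Hr); lra.
  - pose proof (Rmult_le_pos _ _ C_nonneg G_nonneg) as CG.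
    intros e He; exists (e / (C * G + 1)); split.
    { apply Rdiv_lt_0_compat; lra. }
    intros y [_ Hy]; simpl in *; unfold Rdist in *.
    rewrite (slope_nonpos v r), Rminus_0_r by auto.
    destruct (Rle_dec y 0) as [Hy0|Hy0].
    { rewrite slope_nonpos, Rabs_R0; auto. }
    apply Rle_lt_trans with (C * G * y).
    { apply slope_bound; auto; [lra|]; intros; apply nonlinearity_bound. }
    apply Rle_lt_trans with ((C * G + 1) * (y - r)); [nra|].
    rewrite Rabs_right in Hy by lra.
    apply Rmult_lt_reg_r with (/ (C * G + 1)); [apply Rinv_0_lt_compat; lra|].
    replace ((C * G + 1) * (y - r) * / (C * G + 1)) with (y - r) by (field; lra).
    exact Hy.
Qed.

Lemma velocity_continuity (v : R -> R) : continuity v -> continuity (velocity v).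
Proof.
  intros Hv; apply (continuity_comp (slope v) psi).
  - now apply slope_continuity.
  - apply psi_continuity.
Qed.

Lemma picard_deriv (d : R) (v : R -> R) (r : R) :
  continuity v -> has_deriv (picard d v) r (velocity v r).
Proof.
  intros Hv; eapply has_deriv_eq.
  - apply (derivable_pt_lim_plus (fun _ => d) (primitive (velocity v))).
    + apply derivable_pt_lim_const.
    + now apply primitive_deriv, velocity_continuity.
  - ring.
Qed.

Lemma picard_0 (d : R) (v : R -> R) : picard d v 0 = d.
Proof. unfold picard; rewrite primitive_0; ring. Qed.

Lemma picard_lipschitz (d : R) (v : R -> R) (r s : R) :
  continuity v -> Rabs (picard d v r - picard d v s) <= Rabs (r - s).
Proof.
  intros Hv.
  assert (H : forall a b, a <= b ->
      Rabs (picard d v b - picard d v a) <= Rabs (b - a)).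
  { intros a b ab; rewrite (Rabs_right (b - a)), <- (Rmult_1_l (b - a)) by lra.
    apply (deriv_bound_const _ (velocity v)); auto.
    - intros; now apply picard_deriv.
    - intros; left; apply psi_abs_lt_1. }
  destruct (Rle_dec r s); [|apply H; lra].
  rewrite Rabs_minus_sym, (Rabs_minus_sym r); auto.
Qed.

Lemma picard_continuity (d : R) (v : R -> R) :
  continuity v -> continuity (picard d v).
Proof. intros Hv r; eapply has_deriv_continuity_pt, picard_deriv; auto. Qed.

Lemma picard_nonpos (d : R) (v : R -> R) (r : R) :
  continuity v -> r <= 0 -> picard d v r = d.
Proof.
  intros Hv Hr.
  assert (H : Rabs (picard d v 0 - picard d v r) <= 0 * (0 - r)).
  { apply (deriv_bound_const _ (velocity v)); auto.
    - intros; now apply picard_deriv.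
    - intros t Ht; unfold velocity; rewrite slope_nonpos, psi_0, Rabs_R0; auto; lra. }
  rewrite picard_0 in H; apply Rabs_le_between in H; lra.
Qed.

Section TwoArguments.

Context (v1 v2 : R -> R) (M : R).
Context (v1_cont : continuity v1) (v2_cont : continuity v2) (M_nonneg : 0 <= M).
Context (close : forall t, 0 <= t -> Rabs (v1 t - v2 t) <= M * exp (K * t)).

Lemma exp_primitive (a t : R) :
  has_deriv (fun s => a * (exp (K * s) / K)) t (a * exp (K * t)).
Proof. apply is_derive_Reals; auto_derive; auto; field; lra. Qed.

Lemma momentum_close (r : R) : 0 <= r ->
  Rabs (momentum v1 r - momentum v2 r) <= weight r * (C * L * M * exp (K * r) / K).
Proof.
  intros Hr.
  pose proof C_nonneg; pose proof L_nonneg.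
  assert (CLM : 0 <= C * L * M) by (repeat apply Rmult_le_pos; auto).
  pose proof (weight_nonneg r) as W.
  assert (H1 : Rabs ((momentum v1 r - momentum v2 r) - (momentum v1 0 - momentum v2 0))
    <= weight r * (C * L * M) * (exp (K * r) / K)
       - weight r * (C * L * M) * (exp (K * 0) / K)).
  { apply (deriv_bound (fun t => momentum v1 t - momentum v2 t)
      (fun t => - source v1 t - - source v2 t)
      (fun t => weight r * (C * L * M) * (exp (K * t) / K))
      (fun t => weight r * (C * L * M) * exp (K * t))); auto.
    - intros t Ht; apply (derivable_pt_lim_minus (momentum v1) (momentum v2));
        now apply momentum_deriv.
    - intros t Ht; apply exp_primitive.
    - intros t Ht; unfold source.
      replace (_ - _) with (- (weight t * (c t * (g (v1 t) - g (v2 t))))) by ring.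
      rewrite Rabs_Ropp, !Rabs_mult, (Rabs_right (weight t))
        by (apply Rle_ge, weight_nonneg).
      rewrite Rmult_assoc; apply Rmult_le_compat; auto using weight_nonneg.
      + apply Rmult_le_pos; apply Rabs_pos.
      + apply weight_le; lra.
      + rewrite !Rmult_assoc; apply Rmult_le_compat; auto using Rabs_pos.
        apply Rle_trans with (1 := g_lip _ _).
        apply Rmult_le_compat_l; auto; apply close; lra. }
  rewrite !momentum_0, !Rminus_0_r in H1.
  apply Rle_trans with (1 := H1).
  assert (0 <= weight r * (C * L * M) * (exp (K * 0) / K)).
  { apply Rmult_le_pos; [now apply Rmult_le_pos|].
    left; apply Rdiv_lt_0_compat; [apply exp_pos|lra]. }
  apply Rle_trans with (weight r * (C * L * M) * (exp (K * r) / K)); [lra|].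
  right; field; lra.
Qed.

Lemma velocity_close (r : R) : 0 <= r ->
  Rabs (velocity v1 r - velocity v2 r) <= C * L * M * exp (K * r) / K.
Proof.
  intros Hr.
  pose proof C_nonneg; pose proof L_nonneg.
  assert (CLM : 0 <= C * L * M) by (repeat apply Rmult_le_pos; auto).
  apply Rle_trans with (1 := psi_lipschitz _ _).
  destruct (Req_dec r 0) as [->|nr].
  { rewrite !slope_nonpos, Rminus_0_r, Rabs_R0 by (auto; lra).
    apply Rmult_le_pos; [apply Rmult_le_pos; auto; left; apply exp_pos|].
    left; apply Rinv_0_lt_compat; lra. }
  pose proof (weight_pos r ltac:(lra)) as W.
  apply Rmult_le_reg_l with (weight r); auto.
  apply Rle_trans with (2 := momentum_close r Hr).
  rewrite <- (Rabs_right (weight r)) at 1 by lra; rewrite <- Rabs_mult.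
  right; f_equal; unfold slope; field; lra.
Qed.

(** Each of the two integrations leading from [v] to [picard d v] gains a factor
    [1 / K] on [exp (K * r)]; since [2 * (C * L) <= K ^ 2], the Picard map halves
    the distance measured with the weight [exp (K * r)]. *)
Lemma picard_close (d e r : R) : 0 <= r ->
  Rabs (picard d v1 r - picard e v2 r) <= Rabs (d - e) + M / 2 * exp (K * r).
Proof.
  intros Hr.
  pose proof C_nonneg; pose proof L_nonneg.
  assert (CLM : 0 <= C * L * M) by (repeat apply Rmult_le_pos; auto).
  assert (H1 : Rabs ((picard d v1 r - picard e v2 r) - (picard d v1 0 - picard e v2 0))
    <= C * L * M / K * (exp (K * r) / K) - C * L * M / K * (exp (K * 0) / K)).
  { apply (deriv_bound (fun t => picard d v1 t - picard e v2 t)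
      (fun t => velocity v1 t - velocity v2 t)
      (fun t => C * L * M / K * (exp (K * t) / K))
      (fun t => C * L * M / K * exp (K * t))); auto.
    - intros t Ht; apply (derivable_pt_lim_minus (picard d v1) (picard e v2));
        now apply picard_deriv.
    - intros t Ht; apply exp_primitive.
    - intros t Ht; apply Rle_trans with (1 := velocity_close t ltac:(lra)).
      right; field; lra. }
  rewrite !picard_0 in H1.
  replace (picard d v1 r - picard e v2 r)
    with ((d - e) + (picard d v1 r - picard e v2 r - (d - e))) by ring.
  apply Rle_trans with (1 := Rabs_triang _ _), Rplus_le_compat_l.
  apply Rle_trans with (1 := H1).
  assert (0 <= C * L * M / K * (exp (K * 0) / K)).
  { apply Rmult_le_pos.
    - apply Rmult_le_pos; auto; left; apply Rinv_0_lt_compat; lra.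
    - left; apply Rdiv_lt_0_compat; [apply exp_pos|lra]. }
  apply Rle_trans with (C * L / K ^ 2 * (M * exp (K * r))).
  { apply Rle_trans with (C * L * M / K * (exp (K * r) / K)); [lra|].
    right; field; lra. }
  replace (M / 2 * exp (K * r)) with (/ 2 * (M * exp (K * r))) by field.
  apply Rmult_le_compat_r.
  - apply Rmult_le_pos; auto; left; apply exp_pos.
  - apply Rmult_le_reg_r with (K ^ 2); [nra|].
    unfold Rdiv; rewrite Rmult_assoc, Rinv_l, Rmult_1_r by nra; lra.
Qed.

End TwoArguments.

Fixpoint iterate (d : R) (k : nat) : R -> R :=
  match k with
  | O => fun _ => d
  | S k => picard d (iterate d k)
  end.

Lemma iterate_continuity (d : R) (k : nat) : continuity (iterate d k).
Proof.
  induction k as [|k IH]; simpl; [|now apply picard_continuity].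
  intros x; apply continuity_pt_const; now intros ? ?.
Qed.

Lemma iterate_lipschitz (d : R) (k : nat) (r s : R) :
  Rabs (iterate d k r - iterate d k s) <= Rabs (r - s).
Proof.
  destruct k as [|k]; simpl.
  - rewrite Rminus_diag, Rabs_R0; apply Rabs_pos.
  - apply picard_lipschitz, iterate_continuity.
Qed.

Lemma iterate_nonpos (d : R) (k : nat) (r : R) : r <= 0 -> iterate d k r = d.
Proof.
  destruct k as [|k]; simpl; auto; apply picard_nonpos, iterate_continuity.
Qed.

Lemma iterate_step (d : R) (k : nat) (r : R) : 0 <= r ->
  Rabs (iterate d (S k) r - iterate d k r) <= (1 / 2) ^ k * exp (K * r).
Proof.
  revert r; induction k as [|k IH]; intros r Hr.
  - simpl; rewrite Rmult_1_l.
    pose proof (picard_lipschitz d (fun _ => d) r 0 (iterate_continuity d 0)) as H.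
    rewrite picard_0, Rminus_0_r, (Rabs_right r) in H by lra.
    pose proof (exp_ineq1_le (K * r)); nra.
  - apply Rle_trans with (Rabs (d - d) + (1 / 2) ^ k / 2 * exp (K * r)).
    + apply (picard_close (iterate d (S k)) (iterate d k)); auto using iterate_continuity.
      apply pow_le; lra.
    + rewrite Rminus_diag, Rabs_R0; simpl; lra.
Qed.

(** By induction: if the bound holds for [k], one more Picard step turns it into
    [|d - e| + |d - e| * exp (K * r)]. *)
Lemma iterate_dependence (d e : R) (k : nat) (r : R) : 0 <= r ->
  Rabs (iterate d k r - iterate e k r) <= 2 * Rabs (d - e) * exp (K * r).
Proof.
  revert r; induction k as [|k IH]; intros r Hr; pose proof (Rabs_pos (d - e)) as P.
  - simpl; pose proof (exp_ineq1_le (K * r)).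
    assert (1 <= exp (K * r)) by nra. nra.
  - apply Rle_trans with (Rabs (d - e) + 2 * Rabs (d - e) / 2 * exp (K * r)).
    + apply (picard_close (iterate d k) (iterate e k)); auto using iterate_continuity.
      lra.
    + pose proof (exp_ineq1_le (K * r)).
      assert (1 <= exp (K * r)) by nra. nra.
Qed.

Lemma iterate_cauchy (d : R) (k j : nat) (r : R) : 0 <= r ->
  Rabs (iterate d (k + j) r - iterate d k r) <= 2 * (1 / 2) ^ k * exp (K * r).
Proof.
  intros Hr; pose proof (exp_pos (K * r)) as P.
  enough (H : Rabs (iterate d (k + j) r - iterate d k r)
    <= 2 * ((1 / 2) ^ k - (1 / 2) ^ (k + j)) * exp (K * r)).
  { pose proof (pow_lt (1 / 2) (k + j) ltac:(lra)); nra. }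
  induction j as [|j IH].
  - rewrite Nat.add_0_r, !Rminus_diag, Rabs_R0; lra.
  - rewrite Nat.add_succ_r.
    pose proof (iterate_step d (k + j) r Hr) as Hs.
    replace (iterate d (S (k + j)) r - iterate d k r)
      with ((iterate d (S (k + j)) r - iterate d (k + j) r)
            + (iterate d (k + j) r - iterate d k r)) by ring.
    apply Rle_trans with (1 := Rabs_triang _ _).
    change ((1 / 2) ^ S (k + j)) with (1 / 2 * (1 / 2) ^ (k + j)).
    lra.
Qed.

Definition solution (d r : R) : R := real (Lim_seq (fun k => iterate d k r)).

Lemma iterate_converges (d r : R) :
  is_lim_seq (fun k => iterate d k r) (solution d r).
Proof.
  apply Lim_seq_correct'.
  destruct (Rle_dec r 0) as [Hr|Hr].
  { exists d; apply is_lim_seq_ext with (fun _ => d); [|apply is_lim_seq_const].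
    intros k; now rewrite iterate_nonpos. }
  apply ex_lim_seq_cauchy_corr; intros e.
  pose proof (exp_pos (K * r)) as P.
  assert (Pe : 0 < e / (4 * exp (K * r))).
  { apply Rdiv_lt_0_compat; [apply cond_pos|lra]. }
  destruct (pow_lt_1_zero (1 / 2) ltac:(rewrite Rabs_right; lra) _ Pe) as [k0 Hk].
  exists k0; intros i j Hi Hj.
  specialize (Hk k0 (le_n _)); rewrite Rabs_right in Hk
    by (apply Rle_ge, pow_le; lra).
  assert (Hk' : 4 * exp (K * r) * (1 / 2) ^ k0 < e).
  { apply Rmult_lt_reg_r with (/ (4 * exp (K * r))); [apply Rinv_0_lt_compat; lra|].
    replace (4 * exp (K * r) * (1 / 2) ^ k0 * / (4 * exp (K * r)))
      with ((1 / 2) ^ k0) by (field; lra). exact Hk. }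
  pose proof (iterate_cauchy d k0 (i - k0) r ltac:(lra)) as H1.
  pose proof (iterate_cauchy d k0 (j - k0) r ltac:(lra)) as H2.
  replace (k0 + (i - k0))%nat with i in H1 by lia.
  replace (k0 + (j - k0))%nat with j in H2 by lia.
  apply Rabs_le_between in H1; apply Rabs_le_between in H2.
  apply Rabs_def1; lra.
Qed.

(** All iterates have slope at most [1]; this makes the limit continuous without
    uniform convergence. *)
Lemma solution_lipschitz (d r s : R) :
  Rabs (solution d r - solution d s) <= Rabs (r - s).
Proof.
  apply (lim_seq_abs_le (fun k => iterate d k r - iterate d k s)).
  - apply is_lim_seq_minus'; apply iterate_converges.
  - intros k; apply iterate_lipschitz.
Qed.

Lemma solution_continuity (d : R) : continuity (solution d).
Proof.
  intros x e He; exists e; split; auto.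
  intros y [_ Hy]; simpl in *; unfold Rdist in *.
  apply Rle_lt_trans with (2 := Hy), solution_lipschitz.
Qed.

Lemma solution_dependence (d e r : R) : 0 <= r ->
  Rabs (solution d r - solution e r) <= 2 * Rabs (d - e) * exp (K * r).
Proof.
  intros Hr; apply (lim_seq_abs_le (fun k => iterate d k r - iterate e k r)).
  - apply is_lim_seq_minus'; apply iterate_converges.
  - intros k; now apply iterate_dependence.
Qed.

Lemma iterate_rate (d : R) (k : nat) (r : R) : 0 <= r ->
  Rabs (solution d r - iterate d k r) <= 2 * (1 / 2) ^ k * exp (K * r).
Proof.
  intros Hr; apply (lim_seq_abs_le (fun j => iterate d (j + k) r - iterate d k r)).
  - apply is_lim_seq_minus'; [|apply is_lim_seq_const].
    apply (is_lim_seq_incr_n (fun j => iterate d j r)), iterate_converges.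
  - intros j; rewrite Nat.add_comm; now apply iterate_cauchy.
Qed.

Lemma solution_fixed_point (d r : R) : picard d (solution d) r = solution d r.
Proof.
  destruct (Rle_dec r 0) as [Hr|Hr].
  { rewrite picard_nonpos by (auto using solution_continuity).
    assert (H := iterate_converges d r).
    apply is_lim_seq_ext with (v := fun _ => d) in H;
      [|intros k; now apply iterate_nonpos].
    apply is_lim_seq_unique in H; rewrite Lim_seq_const in H; now injection H. }
  apply Rminus_diag_uniq, Rabs_eq_0, Rle_antisym; [|apply Rabs_pos].
  apply Rnot_lt_le; intros Hpos.
  set (D := Rabs _) in Hpos.
  pose proof (exp_pos (K * r)) as P.
  assert (Pe : 0 < D / (4 * exp (K * r))) by (apply Rdiv_lt_0_compat; lra).
  destruct (pow_lt_1_zero (1 / 2) ltac:(rewrite Rabs_right; lra) _ Pe) as [k Hk].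
  specialize (Hk k (le_n _)); rewrite Rabs_right in Hk
    by (apply Rle_ge, pow_le; lra).
  assert (Hk' : 4 * exp (K * r) * (1 / 2) ^ k < D).
  { apply Rmult_lt_reg_r with (/ (4 * exp (K * r))); [apply Rinv_0_lt_compat; lra|].
    replace (4 * exp (K * r) * (1 / 2) ^ k * / (4 * exp (K * r)))
      with ((1 / 2) ^ k) by (field; lra). exact Hk. }
  pose proof (pow_lt (1 / 2) k ltac:(lra)) as Pk.
  assert (H1 : Rabs (picard d (solution d) r - picard d (iterate d k) r)
    <= Rabs (d - d) + 2 * (1 / 2) ^ k / 2 * exp (K * r)).
  { apply picard_close; auto using solution_continuity, iterate_continuity.
    - lra.
    - intros t Ht; now apply iterate_rate. 
    - lra. }
  assert (H2 := iterate_rate d (S k) r ltac:(lra)).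
  simpl in H2; rewrite Rminus_diag, Rabs_R0 in H1.
  enough (D <= 2 * (1 / 2) ^ k * exp (K * r)) by nra.
  unfold D.
  replace (picard d (solution d) r - solution d r)
    with ((picard d (solution d) r - picard d (iterate d k) r)
          + - (solution d r - picard d (iterate d k) r)) by ring.
  apply Rle_trans with (1 := Rabs_triang _ _); rewrite Rabs_Ropp; lra.
Qed.

Lemma solution_at_0 (d : R) : solution d 0 = d.
Proof. rewrite <- solution_fixed_point; apply picard_0. Qed.

Lemma solution_deriv (d r : R) : has_deriv (solution d) r (velocity (solution d) r).
Proof.
  apply has_deriv_ext with (picard d (solution d)).
  - apply solution_fixed_point.
  - apply picard_deriv, solution_continuity.
Qed.

Lemma solution_zero_data (r : R) : solution 0 r = 0.
Proof.
  assert (H : forall k r, iterate 0 k r = 0).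
  { induction k as [|k IH]; intros s; simpl; auto.
    destruct (Rle_dec s 0) as [Hs|Hs]; [apply picard_nonpos; auto using iterate_continuity|].
    assert (Hb : Rabs (picard 0 (iterate 0 k) s - picard 0 (iterate 0 k) 0) <= 0 * (s - 0)).
    { apply (deriv_bound_const _ (velocity (iterate 0 k))); [lra| |].
      - intros; apply picard_deriv, iterate_continuity.
      - intros t Ht.
        assert (Hx : Rabs (slope (iterate 0 k) t) <= 0 * t).
        { apply slope_bound; auto using iterate_continuity; [lra|].
          intros x _; rewrite IH, g_0, Rmult_0_r, Rabs_R0; lra. }
        rewrite Rmult_0_l in Hx; apply Rabs_le_between in Hx.
        unfold velocity; replace (slope (iterate 0 k) t) with 0 by lra.
        rewrite psi_0, Rabs_R0; lra. }
    rewrite picard_0 in Hb; apply Rabs_le_between in Hb; lra. }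
  assert (Hl := iterate_converges 0 r).
  apply is_lim_seq_ext with (v := fun _ => 0) in Hl; [|now intros k].
  apply is_lim_seq_unique in Hl; rewrite Lim_seq_const in Hl; now injection Hl.
Qed.


(** * The angle of a solution in the phase plane *)

Lemma solution_nonpos (d r : R) : r <= 0 -> solution d r = d.
Proof.
  intros Hr; rewrite <- solution_fixed_point.
  now apply picard_nonpos; [apply solution_continuity|].
Qed.

(** Away from the singular point [0] the first-order system is locally
    Lipschitz, so a solution vanishing with its momentum at one point vanishes on
    [(0, r]], hence at [0]. *)
Lemma phase_point_nonzero (d r : R) : d <> 0 ->
  0 < solution d r ^ 2 + momentum (solution d) r ^ 2.
Proof.
  intros nd.
  destruct (Rle_dec r 0) as [Hr|Hr].
  { rewrite (solution_nonpos d r Hr); nra. }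
  apply Rnot_le_lt; intros Hle.
  pose proof C_nonneg as HC; pose proof L_nonneg as HL.
  assert (CL : 0 <= C * L) by now apply Rmult_le_pos.
  (* If [u a = 0] with [a <= |d| / 2], the slope bound forbids [u 0 = d]. *)
  pose (a := Rmin r (Rabs d / 2)).
  assert (Pd : 0 < Rabs d) by now apply Rabs_pos_lt.
  assert (Ha : 0 < a <= r /\ a <= Rabs d / 2).
  { unfold a; split; [split|]; [apply Rmin_glb_lt; lra|apply Rmin_l|apply Rmin_r]. }
  pose proof (weight_pos a ltac:(lra)) as Wa.
  pose proof (weight_nonneg r) as Wr.
  pose (u := solution d); pose (w := momentum u).
  assert (Hg : u a ^ 2 + w a ^ 2 <= (u r ^ 2 + w r ^ 2) *
    exp ((/ weight a + weight r * (C * L)) * (r - a))).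
  { apply (gronwall (fun t => u t ^ 2 + w t ^ 2)
      (fun t => (INR 2 * u t ^ 1) * velocity u t + (INR 2 * w t ^ 1) * (- source u t))).
    - lra.
    - intros t Ht.
      apply (derivable_pt_lim_plus (fun t => u t ^ 2) (fun t => w t ^ 2)).
      + apply (derivable_pt_lim_comp u (fun x => x ^ 2)).
        * apply solution_deriv.
        * apply derivable_pt_lim_pow.
      + apply (derivable_pt_lim_comp w (fun x => x ^ 2)).
        * apply momentum_deriv, solution_continuity.
        * apply derivable_pt_lim_pow.
    - intros t Ht.
      assert (Hv : Rabs (velocity u t) <= / weight a * Rabs (w t)).
      { apply Rle_trans with (1 := psi_abs_le _).
        unfold slope, Rdiv; rewrite Rmult_comm, Rabs_mult, Rabs_right.
        - apply Rmult_le_compat_r; [apply Rabs_pos|].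
          apply Rinv_le_contravar; auto; apply weight_le; lra.
        - left; apply Rinv_0_lt_compat, weight_pos; lra. }
      assert (Hs : Rabs (source u t) <= weight r * (C * L) * Rabs (u t)).
      { unfold source; rewrite Rabs_mult, (Rabs_right (weight t))
          by (apply Rle_ge, weight_nonneg).
        rewrite Rmult_assoc.
        apply Rmult_le_compat; auto using weight_nonneg, Rabs_pos.
        + apply weight_le; lra.
        + rewrite Rabs_mult, Rmult_assoc; apply Rmult_le_compat; auto using Rabs_pos.
          pose proof (g_lip (u t) 0) as H; now rewrite g_0, !Rminus_0_r in H. }
      simpl INR; rewrite !pow_1.
      apply Rle_trans with (2 * Rabs (u t) * Rabs (velocity u t)
        + 2 * Rabs (w t) * Rabs (source u t)).
      { apply Rle_trans with (1 := Rabs_triang _ _).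
        rewrite !Rabs_mult, Rabs_Ropp, (Rabs_right (1 + 1)) by lra; lra. }
      rewrite <- (pow2_abs (u t)), <- (pow2_abs (w t)).
      pose proof (Rabs_pos (u t)) as Pu; pose proof (Rabs_pos (w t)) as Pw.
      set (U := Rabs (u t)) in *; set (W := Rabs (w t)) in *.
      assert (Hq : 2 * U * W <= U ^ 2 + W ^ 2)
        by (clear; pose proof (pow2_ge_0 (U - W)); nra).
      assert (I : 0 < / weight a) by now apply Rinv_0_lt_compat.
      assert (J : 0 <= weight r * (C * L)) by now apply Rmult_le_pos.
      set (i := / weight a) in *; set (j := weight r * (C * L)) in *.
      assert (U * Rabs (velocity u t) <= U * (i * W)) by (apply Rmult_le_compat_l; auto).
      assert (W * Rabs (source u t) <= W * (j * U)) by (apply Rmult_le_compat_l; auto).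
      apply Rle_trans with ((i + j) * (2 * U * W)); [lra|].
      apply Rmult_le_compat_l; lra. }
  change (u r ^ 2 + w r ^ 2 <= 0) in Hle.
  pose proof (pow2_ge_0 (u r)); pose proof (pow2_ge_0 (w r)).
  replace (u r ^ 2 + w r ^ 2) with 0 in Hg by lra.
  rewrite Rmult_0_l in Hg.
  assert (Hua : u a = 0) by (pose proof (pow2_ge_0 (w a)); nra).
  pose proof (solution_lipschitz d a 0) as Hl.
  fold u in Hl; rewrite Hua in Hl; unfold u in Hl; rewrite solution_at_0 in Hl.
  rewrite Rminus_0_l, Rabs_Ropp, Rminus_0_r, (Rabs_right a) in Hl by lra.
  lra.
Qed.

Section Angle.

Context (mu : R) (mu_pos : 0 < mu).

(** The derivative of the argument of [(mu * u, - w)], where [u' = velocity] and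
    [w' = - source]. *)
Definition angular_speed (d r : R) : R :=
  (momentum (solution d) r * (mu * velocity (solution d) r)
     - (- source (solution d) r) * (mu * solution d r))
  / ((mu * solution d r) ^ 2 + momentum (solution d) r ^ 2).

Definition angle (d : R) : R -> R := primitive (angular_speed d).

Lemma scaled_phase_point_nonzero (d r : R) : d <> 0 ->
  0 < (mu * solution d r) ^ 2 + momentum (solution d) r ^ 2.
Proof.
  intros nd; pose proof (phase_point_nonzero d r nd) as H.
  destruct (Req_dec (solution d r) 0) as [E|E].
  - rewrite E in *; nra.
  - assert (mu * solution d r <> 0) by (apply Rmult_integral_contrapositive; split; lra).
    nra.
Qed.

Lemma exp_abs_continuity (k : R) : continuity (fun s => k * exp (K * Rabs s)).
Proof.
  apply (continuity_mult (fun _ => k) (fun s => exp (K * Rabs s))).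
  - apply continuity_const; now intros ? ?.
  - apply (continuity_comp (fun s => K * Rabs s) exp).
    + apply (continuity_mult (fun _ => K) Rabs); [|apply Rcontinuity_abs].
      apply continuity_const; now intros ? ?.
    + apply derivable_continuous, derivable_exp.
Qed.

Lemma solution_continuity_2d (d r : R) : continuity_2d_pt solution d r.
Proof.
  apply lipschitz_in_parameter_continuity_2d with (fun s => 2 * exp (K * Rabs s)).
  - apply solution_continuity.
  - apply exp_abs_continuity.
  - intros e s; destruct (Rle_dec 0 s) as [Hs|Hs].
    + rewrite (Rabs_right s) by lra.
      apply Rle_trans with (1 := solution_dependence e d s Hs); lra.
    + rewrite !solution_nonpos by lra.
      pose proof (exp_ineq1_le (K * Rabs s)); pose proof (Rabs_pos s).
      pose proof (Rabs_pos (e - d)).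
      assert (0 <= K * Rabs s) by (apply Rmult_le_pos; lra). nra.
Qed.

Lemma dependence_bound_nonneg (e d s : R) :
  0 <= C * L * 2 / K * exp (K * Rabs s) * Rabs (e - d).
Proof.
  pose proof C_nonneg; pose proof L_nonneg.
  repeat apply Rmult_le_pos; auto using Rabs_pos; try lra.
  - left; apply Rinv_0_lt_compat; lra.
  - left; apply exp_pos.
Qed.

Lemma momentum_continuity_2d (d r : R) :
  continuity_2d_pt (fun e => momentum (solution e)) d r.
Proof.
  apply lipschitz_in_parameter_continuity_2d
    with (fun s => weight s * (C * L * 2 / K * exp (K * Rabs s))).
  - eapply has_deriv_continuity_pt, momentum_deriv, solution_continuity.
  - apply (continuity_pt_mult weight); [apply weight_continuity|].
    apply exp_abs_continuity.
  - intros e s; destruct (Rle_dec 0 s) as [Hs|Hs].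
    + rewrite (Rabs_right s) by lra.
      apply Rle_trans with (weight s * (C * L * (2 * Rabs (e - d)) * exp (K * s) / K)).
      * apply momentum_close; auto using solution_continuity.
        -- pose proof (Rabs_pos (e - d)); lra.
        -- intros; now apply solution_dependence.
      * right; field; lra.
    + rewrite !momentum_nonpos, Rminus_diag, Rabs_R0
        by (auto using solution_continuity; lra).
      rewrite Rmult_assoc; apply Rmult_le_pos; [apply weight_nonneg|].
      apply dependence_bound_nonneg.
Qed.

Lemma velocity_continuity_2d (d r : R) :
  continuity_2d_pt (fun e => velocity (solution e)) d r.
Proof.
  apply lipschitz_in_parameter_continuity_2d
    with (fun s => C * L * 2 / K * exp (K * Rabs s)).
  - apply velocity_continuity, solution_continuity.
  - apply exp_abs_continuity.
  - intros e s; destruct (Rle_dec 0 s) as [Hs|Hs].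
    + rewrite (Rabs_right s) by lra.
      apply Rle_trans with (C * L * (2 * Rabs (e - d)) * exp (K * s) / K).
      * apply velocity_close; auto using solution_continuity.
        -- pose proof (Rabs_pos (e - d)); lra.
        -- intros; now apply solution_dependence.
      * right; field; lra.
    + unfold velocity; rewrite !slope_nonpos, Rminus_diag, Rabs_R0
        by (auto using solution_continuity; lra).
      apply dependence_bound_nonneg.
Qed.

Lemma source_continuity_2d (d r : R) :
  continuity_2d_pt (fun e => source (solution e)) d r.
Proof.
  apply (continuity_2d_pt_mult (fun _ s => weight s) (fun e s => c s * g (solution e s))).
  - apply (continuity_1d_2d_pt_comp weight (fun _ s => s)).
    + apply weight_continuity.
    + apply continuity_2d_pt_id2.
  - apply (continuity_2d_pt_mult (fun _ s => c s) (fun e s => g (solution e s))).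
    + apply (continuity_1d_2d_pt_comp c (fun _ s => s)); auto.
      apply continuity_2d_pt_id2.
    + apply (continuity_1d_2d_pt_comp g solution).
      * apply g_continuity.
      * apply solution_continuity_2d.
Qed.

Lemma angular_speed_continuity_2d (d r : R) :
  d <> 0 -> continuity_2d_pt angular_speed d r.
Proof.
  intros nd.
  pose proof (solution_continuity_2d d r) as Hu.
  pose proof (momentum_continuity_2d d r) as Hw.
  pose proof (velocity_continuity_2d d r) as Hv.
  pose proof (source_continuity_2d d r) as Hs.
  assert (Hmu : forall f, continuity_2d_pt f d r ->
    continuity_2d_pt (fun e s => mu * f e s) d r).
  { intros f Hf; apply (continuity_2d_pt_mult (fun _ _ => mu)); auto.
    apply continuity_2d_pt_const. }
  assert (Hsq : forall f, continuity_2d_pt f d r ->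
    continuity_2d_pt (fun e s => f e s ^ 2) d r).
  { intros f Hf; apply (continuity_1d_2d_pt_comp (fun x => x ^ 2)); auto.
    eapply has_deriv_continuity_pt, derivable_pt_lim_pow. }
  apply (continuity_2d_pt_mult (fun e s =>
    momentum (solution e) s * (mu * velocity (solution e) s)
    - (- source (solution e) s) * (mu * solution e s))
    (fun e s => / ((mu * solution e s) ^ 2 + momentum (solution e) s ^ 2))).
  - apply continuity_2d_pt_minus; apply continuity_2d_pt_mult; auto.
    now apply continuity_2d_pt_opp.
  - apply continuity_2d_pt_inv.
    + apply continuity_2d_pt_plus; auto.
    + pose proof (scaled_phase_point_nonzero d r nd); lra.
Qed.

Lemma angle_deriv (d r : R) : d <> 0 -> has_deriv (angle d) r (angular_speed d r).
Proof.
  intros nd; apply primitive_deriv; intros s.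
  now apply continuity_2d_pt_section, angular_speed_continuity_2d.
Qed.

Lemma angle_0 (d : R) : angle d 0 = 0.
Proof. apply primitive_0. Qed.

(** The angular speed is jointly continuous, hence uniformly close to the one of
    amplitude [d] on the compact interval [[0, r]]; then integrate. *)
Lemma angle_continuity_parameter (d r : R) : d <> 0 -> 0 <= r ->
  continuity_pt (fun e => angle e r) d.
Proof.
  intros nd Hr; apply continuity_pt_locally; intros eps.
  assert (P : 0 < eps / (r + 1)) by (apply Rdiv_lt_0_compat; [apply cond_pos|lra]).
  destruct (uniform_continuity_2d_1d' angular_speed 0 r d
    (fun s _ => angular_speed_continuity_2d d s nd) (mkposreal _ P)) as [h Hh].
  simpl in Hh.
  assert (Ph : 0 < Rmin h (Rabs d)).
  { apply Rmin_glb_lt; [apply cond_pos|now apply Rabs_pos_lt]. }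
  exists (mkposreal _ Ph); intros e He.
  change (Rabs (e - d) < Rmin h (Rabs d)) in He.
  assert (He1 : Rabs (e - d) < h) by (pose proof (Rmin_l h (Rabs d)); lra).
  assert (He2 : Rabs (e - d) < Rabs d) by (pose proof (Rmin_r h (Rabs d)); lra).
  assert (ne : e <> 0).
  { intros ->; rewrite Rminus_0_l, Rabs_Ropp in He2; lra. }
  assert (H : Rabs ((angle e r - angle d r) - (angle e 0 - angle d 0))
    <= eps / (r + 1) * (r - 0)).
  { apply (deriv_bound_const (fun s => angle e s - angle d s)
      (fun s => angular_speed e s - angular_speed d s)); auto.
    - intros s _; apply (derivable_pt_lim_minus (angle e) (angle d));
        now apply angle_deriv.
    - intros s Hs; left; apply Hh; auto.
      + pose proof (cond_pos h); lra.
      + apply Rabs_def2 in He1; lra.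
      + rewrite Rminus_diag, Rabs_R0; apply cond_pos. }
  rewrite !angle_0, !Rminus_0_r in H.
  apply Rle_lt_trans with (1 := H).
  apply Rlt_le_trans with (eps / (r + 1) * (r + 1)); [nra|].
  right; field; lra.
Qed.

Lemma phase_polar (d : R) : 0 < d -> forall r, exists A, 0 < A /\
  mu * solution d r = A * cos (angle d r) /\
  momentum (solution d) r = - A * sin (angle d r).
Proof.
  intros Hd.
  apply (polar_angle (fun r => mu * solution d r) (momentum (solution d))
    (fun r => mu * velocity (solution d) r) (fun r => - source (solution d) r)
    (angle d)).
  - intros r; apply (derivable_pt_lim_scal (solution d) mu), solution_deriv.
  - intros r; apply momentum_deriv, solution_continuity.
  - intros r; apply scaled_phase_point_nonzero; lra.
  - intros r; apply angle_deriv; lra.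
  - rewrite solution_at_0; nra.
  - apply momentum_0.
  - apply angle_0.
Qed.

(** On the axis [u = 0] the angular speed is [mu * u' / w], and [u'] has the
    sign of [w]: whatever the sign of [c], the axis is crossed in one direction
    only. *)
Lemma angular_speed_pos_on_axis (d r : R) :
  0 < d -> 0 < r -> cos (angle d r) = 0 -> 0 < angular_speed d r.
Proof.
  intros Hd Hr Hc.
  destruct (phase_polar d Hd r) as (A & HA & Hu & _).
  rewrite Hc, Rmult_0_r in Hu.
  pose proof (scaled_phase_point_nonzero d r ltac:(lra)) as HE.
  pose proof (weight_pos r Hr) as Wr.
  unfold angular_speed; rewrite Hu in *.
  set (w := momentum (solution d) r) in *.
  assert (nw : w <> 0) by (intros Z; rewrite Z in HE; lra).
  apply Rdiv_lt_0_compat; auto.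
  rewrite Rmult_0_r, Rminus_0_r.
  assert (nx : slope (solution d) r <> 0).
  { unfold slope; fold w; intros Z; apply nw.
    replace w with (w / weight r * weight r) by (field; lra). rewrite Z; ring. }
  pose proof (mult_psi_pos _ nx) as Hp.
  replace w with (slope (solution d) r * weight r)
    by (unfold slope; fold w; field; lra).
  replace (slope (solution d) r * weight r * (mu * velocity (solution d) r))
    with (mu * weight r * (slope (solution d) r * velocity (solution d) r)) by ring.
  apply Rmult_lt_0_compat; [now apply Rmult_lt_0_compat|exact Hp].
Qed.

Lemma angle_stays_above (d a b th : R) :
  0 < d -> 0 <= a <= b -> cos th = 0 -> th < angle d a -> th < angle d b.
Proof.
  intros Hd Hab Hc Ha.
  apply (stays_above (angle d) (angular_speed d) a); auto; try lra.
  - intros; apply angle_deriv; lra.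
  - intros t Ht E; apply angular_speed_pos_on_axis; [auto|lra|now rewrite E].
Qed.

Lemma angle_continuity (d : R) : d <> 0 -> continuity (angle d).
Proof. intros nd r; eapply has_deriv_continuity_pt, angle_deriv; auto. Qed.

(** Where the angle equals [PI], the vector [(mu * u, - w)] points to the left. *)
Lemma negative_of_angle_ge_PI (d r : R) : 0 < d -> 0 <= r -> PI <= angle d r ->
  exists s, 0 <= s <= r /\ solution d s < 0.
Proof.
  intros Hd Hr Ha; pose proof PI_RGT_0.
  destruct (intermediate_value (angle d) 0 r PI Hr) as (s & Hs & E).
  - intros; apply angle_continuity; lra.
  - rewrite angle_0; lra.
  - exists s; split; auto.
    destruct (phase_polar d Hd s) as (A & HA & Hu & _).
    rewrite E, cos_PI in Hu; nra.
Qed.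


(** * Fast rotation near a point where [q] is positive *)

(** With [c * g (u) = mu * q * signed_pow p (mu * u)] and [x = mu * u], both
    [x' / mu] and [w' / mu] are free of [mu]. *)

Section FrozenEnergy.

Context (p : R) (p_gt1 : 1 < p) (q : R -> R) (d a b eta : R).
Context (d_pos : 0 < d) (a_pos : 0 < a) (ab : a <= b) (qa_pos : 0 < q a).

Let alpha := weight a.
Let kappa := weight a * q a.
Let x r := mu * solution d r.
Let w := momentum (solution d).

Context (nonlinearity : forall t, a <= t <= b ->
  c t * g (solution d t) = mu * (q t * signed_pow p (x t))).
Context (eta_bounds : 0 < eta <= 1 / 2) (eta_le_kappa : eta <= kappa / 2).
Context (freeze_weight : forall t, a <= t <= b -> weight t <= (1 + eta) * alpha).
Context (freeze_q : forall t, a <= t <= b -> Rabs (weight t * q t - kappa) <= eta).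

(** The Hamiltonian, in the variables [mu * u] and [w], of the system whose
    coefficients are frozen at [a]. *)
Definition frozen_energy (e r : R) : R :=
  kinetic (weight a) (momentum (solution e) r)
  + weight a * q a * (mu * solution e r * signed_pow p (mu * solution e r) / (p + 1)).

Let H := frozen_energy d.

Lemma alpha_pos : 0 < alpha.
Proof. now apply weight_pos. Qed.

Lemma kappa_pos : 0 < kappa.
Proof. apply Rmult_lt_0_compat; auto; apply alpha_pos. Qed.

Lemma frozen_energy_nonneg (r : R) : 0 <= H r.
Proof.
  pose proof alpha_pos; pose proof kappa_pos.
  apply Rplus_le_le_0_compat; [now apply kinetic_nonneg|].
  apply Rmult_le_pos; [fold kappa; lra|].
  apply Rmult_le_pos; [apply mult_signed_pow_nonneg; auto|].
  left; apply Rinv_0_lt_compat; lra.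
Qed.

Lemma mult_signed_pow_le_energy (r : R) :
  x r * signed_pow p (x r) <= (p + 1) / kappa * H r.
Proof.
  pose proof alpha_pos; pose proof kappa_pos.
  pose proof (kinetic_nonneg (weight a) (momentum (solution d) r) alpha_pos) as Hkin.
  unfold H, frozen_energy; fold kappa; fold (x r).
  rewrite Rmult_plus_distr_l.
  replace ((p + 1) / kappa * (kappa * (x r * signed_pow p (x r) / (p + 1))))
    with (x r * signed_pow p (x r)) by (field; lra).
  assert (0 <= (p + 1) / kappa * kinetic (weight a) (momentum (solution d) r)).
  { apply Rmult_le_pos; auto; left; apply Rdiv_lt_0_compat; lra. }
  lra.
Qed.

(** For constant coefficients the energy would be conserved; the derivative
    only sees the variation of [weight] and [weight * q] on [[a, b]]. *)
Lemma frozen_energy_drift (t : R) : a <= t <= b ->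
  exists h, has_deriv H t h /\
    Rabs h <= mu * ((kappa + 1) * eta * (1 + (p + 1) / kappa)) * (1 + H t).
Proof.
  intros Ht; pose proof alpha_pos as Pa; pose proof kappa_pos as Pk.
  exists (mu * signed_pow p (x t) *
    (kappa * psi (w t / weight t) - weight t * q t * psi (w t / alpha))).
  split.
  - eapply has_deriv_eq.
    + apply (derivable_pt_lim_plus (fun r => kinetic (weight a) (w r))
        (fun r => kappa * (x r * signed_pow p (x r) / (p + 1)))).
      * apply (derivable_pt_lim_comp w (kinetic (weight a))).
        -- apply momentum_deriv, solution_continuity.
        -- now apply kinetic_deriv.
      * apply (derivable_pt_lim_scal (fun r => x r * signed_pow p (x r) / (p + 1)) kappa).
        apply (derivable_pt_lim_comp x (fun y => y * signed_pow p y / (p + 1))).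
        -- apply (derivable_pt_lim_scal (solution d) mu), solution_deriv.
        -- now apply signed_pow_primitive.
    + unfold source; rewrite nonlinearity by auto.
      change (velocity (solution d) t) with (psi (w t / weight t)).
      unfold alpha; ring.
  - rewrite !Rabs_mult, (Rabs_right mu) by lra; rewrite Rmult_assoc.
    replace (mu * _ * (1 + H t))
      with (mu * ((1 + (p + 1) / kappa) * (1 + H t) * ((kappa + 1) * eta))) by ring.
    apply Rmult_le_compat_l; [lra|].
    pose proof (frozen_energy_nonneg t) as HH.
    assert (Hs : Rabs (signed_pow p (x t)) <= (1 + (p + 1) / kappa) * (1 + H t)).
    { apply Rle_trans with (1 := signed_pow_abs_le p p_gt1 (x t)).
      pose proof (mult_signed_pow_le_energy t).
      assert (0 < (p + 1) / kappa) by (apply Rdiv_lt_0_compat; lra). nra. }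
    assert (Hb : Rabs (kappa * psi (w t / weight t) - weight t * q t * psi (w t / alpha))
      <= (kappa + 1) * eta).
    { pose proof (weight_pos t ltac:(lra)) as Wt.
      assert (Hm : alpha <= weight t) by (apply weight_le; lra).
      pose proof (freeze_weight t Ht) as Hw; pose proof (freeze_q t Ht) as Hq.
      assert (Hk : 1 <= weight t / alpha <= 1 + eta).
      { split; apply Rmult_le_reg_r with alpha; auto; unfold Rdiv;
          rewrite Rmult_assoc, Rinv_l by lra; lra. }
      pose proof (psi_scale_close (w t / weight t) (weight t / alpha) (proj1 Hk)) as Hc.
      replace (weight t / alpha * (w t / weight t)) with (w t / alpha) in Hc
        by (field; lra).
      replace (kappa * psi (w t / weight t) - weight t * q t * psi (w t / alpha))
        with (kappa * (psi (w t / weight t) - psi (w t / alpha))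
              + - ((weight t * q t - kappa) * psi (w t / alpha))) by ring.
      apply Rle_trans with (1 := Rabs_triang _ _).
      rewrite Rabs_Ropp, !Rabs_mult, (Rabs_right kappa) by lra.
      pose proof (psi_abs_lt_1 (w t / alpha)) as H1.
      pose proof (Rabs_pos (psi (w t / alpha))).
      pose proof (Rabs_pos (weight t * q t - kappa)).
      apply Rle_trans with (kappa * eta + eta * 1); [|lra].
      apply Rplus_le_compat; [apply Rmult_le_compat_l; lra|].
      apply Rmult_le_compat; lra. }
    apply Rmult_le_compat; auto using Rabs_pos.
Qed.

(** The constant in [angular_speed_lower_bound]: [2 / 5] bounds the numerator of
    the angular speed from below, and the denominator bounds [x ^ 2 + w ^ 2] from
    above when the energy lies between [3 / 5] and [3 / 2]. *)
Definition turning_rate (al ka : R) : R :=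
  2 / 5 / (1 + 2 * ((p + 1) / ka) + (al + 2) ^ 2).

(** The numerator of the angular speed is [w * psi (w / weight)], comparable to
    the kinetic energy, plus [weight * q * |x|^(p + 1)], comparable to the
    potential one: together they dominate a multiple of the energy. *)
Lemma angular_speed_lower_bound (t : R) : a <= t <= b -> 3 / 5 <= H t <= 3 / 2 ->
  mu * turning_rate alpha kappa <= angular_speed d t.
Proof.
  intros Ht HH; pose proof alpha_pos as Pa; pose proof kappa_pos as Pk.
  pose proof (weight_pos t ltac:(lra)) as Wt.
  assert (Hm : alpha <= weight t) by (apply weight_le; lra).
  pose proof (freeze_weight t Ht) as Hw; pose proof (freeze_q t Ht) as Hq.
  apply Rabs_le_between in Hq.
  pose proof (mult_signed_pow_nonneg p (x t)) as Hs0.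
  pose proof (mult_signed_pow_le_energy t) as HsE.
  assert (Hk : 1 <= weight t / alpha <= 3 / 2).
  { split; apply Rmult_le_reg_r with alpha; auto; unfold Rdiv;
      rewrite Rmult_assoc, Rinv_l by lra; nra. }
  set (num := w t * psi (w t / weight t) + weight t * q t * (x t * signed_pow p (x t))).
  set (den := x t ^ 2 + w t ^ 2).
  assert (E : angular_speed d t = mu * num / den).
  { unfold angular_speed, source; rewrite nonlinearity by auto.
    change (velocity (solution d) t) with (psi (w t / weight t)).
    change (mu * solution d t) with (x t); change (momentum (solution d)) with w.
    unfold num, den, Rdiv; ring. }
  assert (Hden : 0 < den) by (apply scaled_phase_point_nonzero; lra).
  assert (Hnum : 2 / 5 <= num).
  { assert (H1 : 2 / 3 * kinetic alpha (w t) <= w t * psi (w t / weight t)).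
    { pose proof (kinetic_le alpha (w t) Pa) as H1.
      pose proof (mult_psi_scale (w t / weight t) (weight t / alpha) (proj1 Hk)) as H2.
      replace (weight t / alpha * (w t / weight t)) with (w t / alpha) in H2
        by (field; lra).
      set (P1 := psi (w t / alpha)) in *; set (P2 := psi (w t / weight t)) in *.
      assert (H3 : w t * P1 <= weight t / alpha * (w t * P2)).
      { replace (w t * P1) with (weight t * (w t / weight t * P1)) by (field; lra).
        replace (weight t / alpha * (w t * P2))
          with (weight t * (weight t / alpha * (w t / weight t * P2))) by (field; lra).
        apply Rmult_le_compat_l; lra. }
      pose proof (kinetic_nonneg alpha (w t) Pa).
      assert (0 < weight t / alpha) by lra.
      assert (0 <= w t * P2).
      { apply Rmult_le_reg_l with (weight t / alpha); lra. }
      assert (weight t / alpha * (w t * P2) <= 3 / 2 * (w t * P2))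
        by (apply Rmult_le_compat_r; lra).
      lra. }
    assert (H2 : kappa * (x t * signed_pow p (x t) / (p + 1))
      <= weight t * q t * (x t * signed_pow p (x t))).
    { apply Rle_trans with (kappa / 2 * (x t * signed_pow p (x t))).
      - replace (kappa * (x t * signed_pow p (x t) / (p + 1)))
          with (kappa * (x t * signed_pow p (x t)) * / (p + 1)) by (field; lra).
        replace (kappa / 2 * (x t * signed_pow p (x t)))
          with (kappa * (x t * signed_pow p (x t)) * / 2) by field.
        apply Rmult_le_compat_l; [apply Rmult_le_pos; lra|].
        apply Rinv_le_contravar; lra.
      - apply Rmult_le_compat_r; lra. }
    assert (EH : H t = kinetic alpha (w t)
      + kappa * (x t * signed_pow p (x t) / (p + 1))) by reflexivity.
    assert (0 <= kappa * (x t * signed_pow p (x t) / (p + 1))).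
    { apply Rmult_le_pos; [lra|]; apply Rmult_le_pos; auto.
      left; apply Rinv_0_lt_compat; lra. }
    unfold num; lra. }
  assert (HD : den <= 1 + 2 * ((p + 1) / kappa) + (alpha + 2) ^ 2).
  { assert (0 < (p + 1) / kappa) by (apply Rdiv_lt_0_compat; lra).
    pose proof (sqr_le_mult_signed_pow p p_gt1 (x t)) as H1.
    pose proof (momentum_le_kinetic alpha (w t) Pa) as H2.
    assert (H3 : kinetic alpha (w t) <= H t).
    { unfold H, frozen_energy; fold kappa; fold (x t); fold w.
      enough (0 <= kappa * (x t * signed_pow p (x t) / (p + 1))) by (unfold alpha; lra).
      apply Rmult_le_pos; [lra|]; apply Rmult_le_pos; auto.
      left; apply Rinv_0_lt_compat; lra. }
    assert (w t ^ 2 <= (alpha + 2) ^ 2).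
    { rewrite <- pow2_abs; apply pow_incr; split; [apply Rabs_pos|lra]. }
    unfold den; nra. }
  rewrite E; unfold Rdiv; rewrite Rmult_assoc; apply Rmult_le_compat_l; [lra|].
  unfold turning_rate, Rdiv.
  apply Rmult_le_compat; try lra.
  - left; apply Rinv_0_lt_compat; lra.
  - apply Rinv_le_contravar; auto.
Qed.

(** Rescaled by [mu], the solution turns for a time [mu * (b - a)] at a speed
    bounded below, as long as the drift of the energy over that time is small. *)
Lemma angle_increment :
  H a = 1 ->
  mu * (b - a) * ((kappa + 1) * eta * (1 + (p + 1) / kappa)) <= 1 / 5 ->
  mu * (b - a) * turning_rate alpha kappa <= angle d b - angle d a.
Proof.
  intros Ha Hdrift; pose proof kappa_pos as Pk.
  set (B := mu * ((kappa + 1) * eta * (1 + (p + 1) / kappa))).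
  assert (PB : 0 <= B).
  { assert (0 < (p + 1) / kappa) by (apply Rdiv_lt_0_compat; lra).
    unfold B; repeat apply Rmult_le_pos; lra. }
  assert (HE : forall t, a <= t <= b -> 3 / 5 <= H t <= 3 / 2).
  { intros t Ht.
    assert (HD : forall s, a <= s <= t -> has_deriv (fun r => 1 + H r) s (Derive H s)
      /\ Rabs (Derive H s) <= B * (1 + H s)).
    { intros s Hs; destruct (frozen_energy_drift s ltac:(lra)) as (h & Hh & Hb).
      replace (Derive H s) with h
        by (symmetry; apply is_derive_unique; now apply is_derive_Reals).
      split; auto; eapply has_deriv_eq.
      - apply (derivable_pt_lim_plus (fun _ => 1) H); eauto.
        apply derivable_pt_lim_const.
      - ring. }
    destruct (gronwall (fun r => 1 + H r) (Derive H) B a t) as [H1 H2].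
    - lra.
    - intros s Hs; now apply HD.
    - intros s Hs; now apply HD.
    - rewrite Ha in H1, H2.
      (* From [1 + H a = 2], a factor [5 / 4] leads to [8 / 5] or [5 / 2]. *)
      assert (Hx : exp (B * (t - a)) <= 5 / 4).
      { pose proof (exp_ineq1_le (- (B * (t - a)))) as He.
        rewrite exp_Ropp in He.
        assert (B * (t - a) <= 1 / 5).
        { apply Rle_trans with (B * (b - a)); [apply Rmult_le_compat_l; lra|].
          unfold B; lra. }
        pose proof (exp_pos (B * (t - a))) as Pe.
        assert (He' : 4 / 5 <= / exp (B * (t - a))) by lra.
        apply Rmult_le_reg_r with (/ exp (B * (t - a)));
          [now apply Rinv_0_lt_compat|].
        rewrite Rinv_r by lra; lra. }
      pose proof (frozen_energy_nonneg t).
      pose proof (exp_pos (B * (t - a))).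
      split; nra. }
  replace (mu * (b - a) * turning_rate alpha kappa)
    with (mu * turning_rate alpha kappa * b - mu * turning_rate alpha kappa * a) by ring.
  enough (angle d a - mu * turning_rate alpha kappa * a
    <= angle d b - mu * turning_rate alpha kappa * b) by lra.
  apply (nonneg_deriv_le (fun t => angle d t - mu * turning_rate alpha kappa * t)
    (fun t => angular_speed d t - mu * turning_rate alpha kappa)); auto.
  - intros t Ht; apply (derivable_pt_lim_minus (angle d)
      (fun t => mu * turning_rate alpha kappa * t)).
    + apply angle_deriv; lra.
    + apply is_derive_Reals; auto_derive; auto; ring.
  - intros t Ht; pose proof (angular_speed_lower_bound t Ht (HE t Ht)); lra.
Qed.

End FrozenEnergy.

End Angle.

(** * Amplitudes with a prescribed angle at the boundary *)

Lemma solution_nonneg_of_large_amplitude (d r : R) :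
  0 <= r <= d -> 0 <= solution d r.
Proof.
  intros H; pose proof (solution_lipschitz d r 0) as Hl.
  rewrite solution_at_0, Rminus_0_r, (Rabs_right r) in Hl by lra.
  apply Rabs_le_between in Hl; lra.
Qed.

Lemma solution_abs_le (d r : R) : 0 <= d -> 0 <= r -> Rabs (solution d r) <= d + r.
Proof.
  intros Hd Hr; pose proof (solution_lipschitz d r 0) as Hl.
  rewrite solution_at_0, Rminus_0_r, (Rabs_right r) in Hl by lra.
  apply Rabs_le_between in Hl; apply Rabs_le; lra.
Qed.

Lemma momentum_zero_data (r : R) : 0 <= r -> momentum (solution 0) r = 0.
Proof.
  intros Hr.
  assert (H : Rabs (momentum (solution 0) r) <= weight r * 0 * r).
  { apply momentum_bound; auto using solution_continuity.
    intros t _; rewrite solution_zero_data, g_0, Rmult_0_r, Rabs_R0; lra. }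
  rewrite Rmult_0_r, Rmult_0_l in H; apply Rabs_le_between in H; lra.
Qed.

(** A superlinear nonlinearity acts on a solution of small amplitude [d] by a
    quantity [o(d)], too little to bring it down to [0] before [rho]. *)
Lemma solution_nonneg_of_small_amplitude (rho : R) : 0 <= rho ->
  (forall eta, 0 < eta -> exists delta, 0 < delta /\
     forall x, Rabs x <= delta -> Rabs (g x) <= eta * Rabs x) ->
  exists d0, 0 < d0 /\
    forall d r, 0 < d <= d0 -> 0 <= r <= rho -> 0 <= solution d r.
Proof.
  intros Hrho Hg.
  pose proof C_nonneg as HC.
  set (B := 2 * exp (K * rho)).
  assert (PB : 0 < B) by (unfold B; pose proof (exp_pos (K * rho)); lra).
  set (eta := / ((C + 1) * B * (rho + 1) ^ 2)).
  assert (PD : 0 < (C + 1) * B * (rho + 1) ^ 2).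
  { apply Rmult_lt_0_compat; [apply Rmult_lt_0_compat; lra|apply pow_lt; lra]. }
  assert (Peta : 0 < eta) by now apply Rinv_0_lt_compat.
  destruct (Hg eta Peta) as (delta & Pdelta & Hsmall).
  exists (delta / B); split; [now apply Rdiv_lt_0_compat|].
  intros d r Hd Hr.
  assert (HdB : B * d <= delta).
  { apply Rle_trans with (B * (delta / B)); [apply Rmult_le_compat_l; lra|].
    right; field; lra. }
  assert (Hu : forall t, 0 <= t <= rho -> Rabs (solution d t) <= B * d).
  { intros t Ht; pose proof (solution_dependence d 0 t (proj1 Ht)) as H.
    rewrite solution_zero_data, !Rminus_0_r, (Rabs_right d) in H by lra.
    apply Rle_trans with (1 := H).
    assert (exp (K * t) <= exp (K * rho)).
    { destruct (Req_dec t rho) as [->|]; [lra|].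
      left; apply exp_increasing, Rmult_lt_compat_l; lra. }
    unfold B; replace (2 * exp (K * rho) * d) with (2 * d * exp (K * rho)) by ring.
    apply Rmult_le_compat_l; lra. }
  assert (Hv : forall t, 0 <= t <= r ->
    Rabs (velocity (solution d) t) <= C * (eta * (B * d)) * rho).
  { intros t Ht; apply Rle_trans with (1 := psi_abs_le _).
    assert (P : 0 <= C * (eta * (B * d))).
    { apply Rmult_le_pos; auto; apply Rmult_le_pos; [lra|]; apply Rmult_le_pos; lra. }
    apply Rle_trans with (C * (eta * (B * d)) * t).
    - apply slope_bound; [apply solution_continuity|lra|].
      intros s Hs; rewrite Rabs_mult; apply Rmult_le_compat; auto using Rabs_pos.
      specialize (Hu s ltac:(lra)).
      apply Rle_trans with (eta * Rabs (solution d s)); [apply Hsmall; lra|].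
      apply Rmult_le_compat_l; lra.
    - apply Rmult_le_compat_l; lra. }
  pose proof (deriv_bound_const (solution d) (velocity (solution d)) _ 0 r (proj1 Hr)
    (fun t _ => solution_deriv d t) Hv) as H.
  rewrite solution_at_0, Rminus_0_r in H.
  assert (Hfin : C * (eta * (B * d)) * rho * r <= d).
  { apply Rle_trans with ((C + 1) * (eta * (B * d)) * (rho + 1) * (rho + 1)).
    - assert (0 <= eta * (B * d)).
      { apply Rmult_le_pos; [lra|]; apply Rmult_le_pos; lra. }
      assert (0 <= C * (eta * (B * d)) <= (C + 1) * (eta * (B * d))).
      { split; [now apply Rmult_le_pos|]; apply Rmult_le_compat_r; lra. }
      apply Rmult_le_compat; try lra.
      + apply Rmult_le_pos; lra.
      + apply Rmult_le_compat; lra.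
    - right; unfold eta; field; lra. }
  apply Rabs_le_between in H; lra.
Qed.

Section Crossing.

Context (mu : R) (mu_pos : 0 < mu).

Lemma amplitude_with_angle (rho dn ds : R) (j : nat) :
  0 < rho -> 0 < dn -> 0 < ds -> (1 <= j)%nat ->
  (forall r, 0 <= r <= rho -> 0 <= solution dn r) ->
  INR j * PI + PI / 2 < angle mu ds rho ->
  exists d, Rmin dn ds <= d <= Rmax dn ds /\ angle mu d rho = INR j * PI + PI / 2.
Proof.
  intros Hrho Hdn Hds Hj Hnonneg Hs.
  pose proof PI_RGT_0 as HPI.
  assert (Hj' : 1 <= INR j) by (apply (le_INR 1); auto).
  assert (Hn : angle mu dn rho < PI).
  { apply Rnot_le_lt; intros Hle.
    destruct (negative_of_angle_ge_PI mu mu_pos dn rho Hdn) as (s & Hs1 & Hs2);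
      [lra|auto|].
    specialize (Hnonneg s Hs1); lra. }
  assert (Hjp : PI <= INR j * PI) by nra.
  assert (Hc : forall e, Rmin dn ds <= e <= Rmax dn ds ->
    continuity_pt (fun e => angle mu e rho) e).
  { intros e He; apply angle_continuity_parameter; auto; [|lra].
    assert (0 < Rmin dn ds) by now apply Rmin_glb_lt. lra. }
  destruct (Rle_dec dn ds) as [H|H].
  - rewrite Rmin_left, Rmax_right in * by lra.
    apply (intermediate_value (fun e => angle mu e rho)); auto; lra.
  - rewrite Rmin_right, Rmax_left in * by lra.
    apply (intermediate_value (fun e => angle mu e rho)); auto; lra.
Qed.

Lemma sign_changing_of_angle (rho d : R) (j : nat) :
  0 < rho -> 0 < d -> (1 <= j)%nat -> angle mu d rho = INR j * PI + PI / 2 ->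
  solution d rho = 0 /\ exists s, 0 <= s <= rho /\ solution d s < 0.
Proof.
  intros Hrho Hd Hj E; pose proof PI_RGT_0 as HPI.
  assert (Hj' : 1 <= INR j) by (apply (le_INR 1); auto).
  split.
  - destruct (phase_polar mu mu_pos d Hd rho) as (A & HA & Hu & _).
    rewrite E, cos_half_turn, Rmult_0_r in Hu; nra.
  - apply (negative_of_angle_ge_PI mu); auto; [lra|]; rewrite E; nra.
Qed.

(** At [a] the solution of amplitude [0] has energy [0], the one of amplitude
    [rho] at least [1]: having slope less than [1], it keeps [u a >= rho - a]. *)
Lemma amplitude_with_unit_energy (p : R) (q : R -> R) (a rho : R) :
  1 < p -> 0 < a < rho -> 0 < q a ->
  1 + (p + 1) / (weight a * q a) <= mu * (rho - a) ->
  exists d, 0 < d <= rho /\ frozen_energy mu p q a d a = 1.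
Proof.
  intros Hp Ha Hq Hmu.
  pose proof (weight_pos a (proj1 Ha)) as Wa.
  set (kappa := weight a * q a) in *.
  assert (Pk : 0 < kappa) by now apply Rmult_lt_0_compat.
  assert (H0 : frozen_energy mu p q a 0 a = 0).
  { unfold frozen_energy; rewrite solution_zero_data, momentum_zero_data by lra.
    unfold kinetic; replace (1 + (0 / weight a) ^ 2) with 1 by (field; lra).
    rewrite sqrt_1; unfold Rdiv; ring. }
  assert (H1 : 1 <= frozen_energy mu p q a rho a).
  { unfold frozen_energy; fold kappa.
    pose proof (kinetic_nonneg (weight a) (momentum (solution rho) a) Wa).
    set (x := mu * solution rho a).
    assert (Hx : 1 + (p + 1) / kappa <= x).
    { apply Rle_trans with (1 := Hmu); apply Rmult_le_compat_l; [lra|].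
      pose proof (solution_lipschitz rho a 0) as Hl.
      rewrite solution_at_0, Rminus_0_r, (Rabs_right a) in Hl by lra.
      apply Rabs_le_between in Hl; lra. }
    assert (P : 0 < (p + 1) / kappa) by (apply Rdiv_lt_0_compat; lra).
    pose proof (mult_signed_pow_ge p Hp x ltac:(rewrite Rabs_right; lra)) as Hs.
    assert (Hx2 : (p + 1) / kappa <= x * signed_pow p x).
    { apply Rle_trans with (2 := Hs); clear - Hx P; nra. }
    enough (1 <= kappa * (x * signed_pow p x / (p + 1))) by lra.
    apply Rle_trans with (kappa * ((p + 1) / kappa / (p + 1))).
    - right; field; lra.
    - apply Rmult_le_compat_l; [lra|]; apply Rmult_le_compat_r; auto.
      left; apply Rinv_0_lt_compat; lra. }
  destruct (intermediate_value (fun e => frozen_energy mu p q a e a) 0 rho 1)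
    as (d & Hd & E); [lra| |lra|].
  - intros e _; unfold frozen_energy.
    apply (continuity_pt_plus (fun e => kinetic (weight a) (momentum (solution e) a))
      (fun e => weight a * q a *
        (mu * solution e a * signed_pow p (mu * solution e a) / (p + 1)))).
    + apply (continuity_pt_comp (fun e => momentum (solution e) a) (kinetic (weight a))).
      * apply (continuity_2d_pt_section_l (fun e => momentum (solution e))).
        apply momentum_continuity_2d.
      * eapply has_deriv_continuity_pt, kinetic_deriv; auto.
    + apply (continuity_pt_scal (fun e =>
        mu * solution e a * signed_pow p (mu * solution e a) / (p + 1)) (weight a * q a)).
      apply (continuity_pt_comp (fun e => mu * solution e a)
        (fun x => x * signed_pow p x / (p + 1))).
      * apply (continuity_pt_scal (fun e => solution e a) mu).
        apply continuity_2d_pt_section_l, solution_continuity_2d.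
      * eapply has_deriv_continuity_pt, signed_pow_primitive; auto.
  - exists d; split; auto.
    destruct (Req_dec d 0) as [->|]; lra.
Qed.

(** For a small amplitude and for the amplitude [rho] the angle at [rho] is less
    than [PI], so [amplitude_with_angle] applies on both sides of [ds].  On one
    side amplitudes are told apart by their angles, and [ds] itself, whose angle
    is larger, separates the two sides. *)
Lemma many_amplitudes (rho ds : R) (k : nat) :
  0 < rho -> 0 < ds <= rho ->
  (forall eta, 0 < eta -> exists delta, 0 < delta /\
     forall x, Rabs x <= delta -> Rabs (g x) <= eta * Rabs x) ->
  INR k * PI + PI / 2 < angle mu ds rho ->
  exists D : nat -> R,
    (forall i, (i < 2 * k)%nat -> 0 < D i <= rho /\ solution (D i) rho = 0 /\
       exists s, 0 <= s <= rho /\ solution (D i) s < 0) /\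
    (forall i j, (i < 2 * k)%nat -> (j < 2 * k)%nat -> D i = D j -> i = j).
Proof.
  intros Hrho Hds Hg Hturn; pose proof PI_RGT_0 as HPI.
  destruct (solution_nonneg_of_small_amplitude rho ltac:(lra) Hg) as (d0 & Hd0 & Hsmall).
  set (dn := Rmin d0 ds).
  assert (Hdn : 0 < dn) by (apply Rmin_glb_lt; lra).
  assert (Hdn0 : dn <= d0) by apply Rmin_l.
  assert (Hdns : dn <= ds) by apply Rmin_r.
  assert (Hang : forall j, (j < k)%nat -> INR (S j) * PI + PI / 2 < angle mu ds rho).
  { intros j Hj; assert (INR (S j) <= INR k) by (apply le_INR; lia). nra. }
  assert (Hex : forall i, exists d, (i < 2 * k)%nat ->
    0 < d <= rho /\
    ((i < k)%nat -> d <= ds /\ angle mu d rho = INR (S i) * PI + PI / 2) /\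
    ((k <= i)%nat -> ds <= d /\ angle mu d rho = INR (S (i - k)) * PI + PI / 2)).
  { intros i; destruct (le_lt_dec (2 * k) i) as [Hi|Hi]; [exists 0; lia|].
    destruct (le_lt_dec k i) as [Hk|Hk].
    - destruct (amplitude_with_angle rho rho ds (S (i - k))) as (d & Hd & E);
        [lra|lra|lra|lia| |apply Hang; lia|].
      { intros r Hr; now apply solution_nonneg_of_large_amplitude. }
      rewrite Rmin_right, Rmax_left in Hd by lra.
      exists d; intros _; split; [lra|]; split; [lia|]; split; auto; lra.
    - destruct (amplitude_with_angle rho dn ds (S i)) as (d & Hd & E);
        [lra|lra|lra|lia| |apply Hang; lia|].
      { intros r Hr; apply Hsmall; lra. }
      rewrite Rmin_left, Rmax_right in Hd by lra.
      exists d; intros _; split; [lra|]; split; [|lia]; split; auto; lra. }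
  exists (fun i => proj1_sig (constructive_indefinite_description _ (Hex i))).
  assert (Hspec := fun i => proj2_sig (constructive_indefinite_description _ (Hex i))).
  set (D := fun i => proj1_sig (constructive_indefinite_description _ (Hex i))) in *.
  change (forall i, (i < 2 * k)%nat ->
    0 < D i <= rho /\
    ((i < k)%nat -> D i <= ds /\ angle mu (D i) rho = INR (S i) * PI + PI / 2) /\
    ((k <= i)%nat -> ds <= D i /\ angle mu (D i) rho = INR (S (i - k)) * PI + PI / 2))
    in Hspec.
  split.
  - intros i Hi; destruct (Hspec i Hi) as (H1 & H2 & H3); split; auto.
    destruct (le_lt_dec k i) as [Hk|Hk].
    + apply (sign_changing_of_angle rho (D i) (S (i - k))); try lra; [lia|]; now apply H3.
    + apply (sign_changing_of_angle rho (D i) (S i)); try lra; [lia|]; now apply H2.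
  - assert (Hinj : forall a b, INR (S a) * PI + PI / 2 = INR (S b) * PI + PI / 2 -> a = b).
    { intros a b E; assert (INR (S a) = INR (S b)) as E' by nra.
      apply INR_eq in E'; lia. }
    assert (Hmix : forall i j, (i < k)%nat -> (k <= j < 2 * k)%nat -> D i <> D j).
    { intros i j Hi Hj E.
      destruct (Hspec i ltac:(lia)) as (_ & H2 & _); destruct (H2 Hi) as [L1 A1].
      destruct (Hspec j ltac:(lia)) as (_ & _ & H3); destruct (H3 (proj1 Hj)) as [L2 _].
      replace (D i) with ds in A1 by lra.
      pose proof (Hang i Hi); lra. }
    intros i j Hi Hj E; fold (D i) in E; fold (D j) in E.
    destruct (Hspec i Hi) as (_ & I2 & I3); destruct (Hspec j Hj) as (_ & J2 & J3).
    destruct (le_lt_dec k i) as [Hki|Hki], (le_lt_dec k j) as [Hkj|Hkj].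
    + destruct (I3 Hki) as [_ A1]; destruct (J3 Hkj) as [_ A2].
      rewrite E, A2 in A1; apply Hinj in A1; lia.
    + exfalso; apply (Hmix j i); auto; lia.
    + exfalso; apply (Hmix i j); auto; lia.
    + destruct (I2 Hki) as [_ A1]; destruct (J2 Hkj) as [_ A2].
      rewrite E, A2 in A1; apply Hinj in A1; lia.
Qed.

(** Before [a], where nothing is known on the sign of [q], the angle may decrease,
    but it never passes below [- PI / 2]; after [b] it never comes back. *)
Lemma amplitude_with_many_turns (p : R) (q : R -> R) (rho a b eta : R) (k : nat) :
  1 < p -> 0 < a < rho -> a <= b <= rho -> 0 < q a ->
  (forall d t, 0 <= d <= rho -> 0 <= t <= rho ->
     c t * g (solution d t) = mu * (q t * signed_pow p (mu * solution d t))) ->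
  0 < eta <= 1 / 2 -> eta <= weight a * q a / 2 ->
  (forall t, a <= t <= b -> weight t <= (1 + eta) * weight a) ->
  (forall t, a <= t <= b -> Rabs (weight t * q t - weight a * q a) <= eta) ->
  1 + (p + 1) / (weight a * q a) <= mu * (rho - a) ->
  mu * (b - a) * ((weight a * q a + 1) * eta * (1 + (p + 1) / (weight a * q a))) <= 1 / 5 ->
  INR (S k) * PI <= mu * (b - a) * turning_rate p (weight a) (weight a * q a) ->
  exists d, 0 < d <= rho /\ INR k * PI + PI / 2 < angle mu d rho.
Proof.
  intros Hp Ha Hb Hqa Hnl He1 He2 Hfw Hfq Hmu Hdrift Hturn.
  pose proof PI_RGT_0 as HPI.
  destruct (amplitude_with_unit_energy p q a rho Hp Ha Hqa Hmu) as (d & Hd & HE).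
  exists d; split; auto.
  assert (Hinc : mu * (b - a) * turning_rate p (weight a) (weight a * q a)
    <= angle mu d b - angle mu d a).
  { apply (angle_increment mu mu_pos p Hp q d a b eta); auto; try lra.
    intros t Ht; apply Hnl; lra. }
  assert (Hlow : - (PI / 2) < angle mu d a).
  { apply (angle_stays_above mu mu_pos d 0 a); try lra.
    - now rewrite cos_neg, cos_PI2.
    - rewrite angle_0; lra. }
  apply (angle_stays_above mu mu_pos d b rho); try lra.
  - apply cos_half_turn.
  - rewrite S_INR in Hturn; lra.
Qed.

End Crossing.

(** Multiplying by [sigma = -1] gives the opposite solution, as [phi] and
    [signed_pow p] are odd. *)
Lemma solution_profile (N : nat) (rho p lam d sigma : R) (q : R -> R) :
  (N - 1)%nat = n -> 0 < rho -> sigma = 1 \/ sigma = -1 ->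
  (forall r, 0 <= r <= rho ->
     c r * g (solution d r) = lam * q r * signed_pow p (solution d r)) ->
  solution d rho = 0 ->
  radial_profile N rho p q lam (fun r => sigma * solution d r).
Proof.
  intros HN Hrho Hsigma Hnl Hend.
  set (v := velocity (solution d)); set (w := momentum (solution d)).
  assert (Hsp : forall x, signed_pow p (sigma * x) = sigma * signed_pow p x).
  { intros x; destruct Hsigma as [->| ->].
    - now rewrite !Rmult_1_l.
    - unfold signed_pow; rewrite Rabs_mult, Rabs_m1, Rmult_1_l; ring. }
  assert (Hphi : forall x, phi (sigma * x) = sigma * phi x).
  { intros x; unfold phi; replace ((sigma * x) ^ 2) with (x ^ 2).
    - unfold Rdiv; ring.
    - destruct Hsigma as [->| ->]; ring. }
  assert (Habs : forall x, Rabs (sigma * x) = Rabs x).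
  { intros x; rewrite Rabs_mult; destruct Hsigma as [->| ->];
      rewrite ?Rabs_R1, ?Rabs_m1; ring. }
  assert (Hscal : forall f, continuity f -> continuity (fun r => sigma * f r)).
  { intros f Hf; now apply (continuity_scal f sigma). }
  exists (fun r => sigma * v r), (fun r => sigma * - source (solution d) r).
  rewrite HN; split; [|split; [|split; [|split; [|split]]]].
  - apply C1_on_Icc_of_has_deriv with (fun r => sigma * solution d r); auto.
    + intros r; apply (derivable_pt_lim_scal (solution d) sigma), solution_deriv.
    + apply Hscal, velocity_continuity, solution_continuity.
  - intros r _; rewrite Habs; apply psi_abs_lt_1.
  - apply C1_on_Icc_of_has_deriv with (fun r => sigma * w r).
    + intros r [Hr _]; rewrite Hphi.
      change (v r) with (psi (slope (solution d) r)); rewrite phi_psi.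
      destruct (Req_dec r 0) as [->|nr].
      * rewrite pow_i by lia; unfold w; rewrite momentum_0; ring.
      * unfold slope; rewrite weight_eq by auto; fold w.
        field; apply pow_nonzero; auto.
    + intros r; apply (derivable_pt_lim_scal w sigma), momentum_deriv, solution_continuity.
    + apply Hscal; apply (continuity_opp (source (solution d))).
      apply source_continuity, solution_continuity.
  - intros r Hr; rewrite Hsp; unfold source.
    rewrite weight_eq by apply Hr; rewrite Hnl by exact Hr; ring.
  - unfold v, velocity; rewrite slope_nonpos, psi_0; [ring|apply solution_continuity|lra].
  - rewrite Hend; ring.
Qed.

End RadialIVP.

(** * From the initial value problem to the boundary value problem *)

(** The point [(r, 0, ..., 0)]. *)
Lemma point_of_norm (N : nat) (r : R) : (1 <= N)%nat -> 0 <= r ->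
  exists x : Vector.t R N, enorm x = r.
Proof.
  intros HN Hr; destruct N as [|N]; [lia|].
  exists (Vector.cons R r N (Vector.const 0 N)).
  change (sqrt (r ^ 2 + Vector.fold_right (fun t s => t ^ 2 + s) (Vector.const 0 N) 0) = r).
  replace (Vector.fold_right (fun t s => t ^ 2 + s) (Vector.const 0 N) 0) with 0.
  - replace (r ^ 2 + 0) with (Rsqr r) by (unfold Rsqr; ring).
    now apply sqrt_Rsqr.
  - symmetry; clear; induction N as [|N IH]; [reflexivity|].
    change (0 ^ 2 + Vector.fold_right (fun t s => t ^ 2 + s) (Vector.const 0 N) 0 = 0).
    rewrite IH; ring.
Qed.

(** Extension by constants turns continuity inside [[0, rho]] into continuity on
    the line. *)
Lemma continuity_clamped (rho : R) (q : R -> R) : 0 < rho ->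
  continuous_on_Icc 0 rho q -> continuity (fun r => q (Rmax 0 (Rmin rho r))).
Proof.
  intros Hrho Hq r.
  set (s := fun r => Rmax 0 (Rmin rho r)).
  assert (Hs : forall r, Icc 0 rho (s r)).
  { intros y; unfold s, Icc; split; [apply Rmax_l|].
    apply Rmax_lub; [lra|apply Rmin_l]. }
  assert (Hlip : forall x y, Rabs (s x - s y) <= Rabs (x - y)).
  { intros x y; unfold s, Rmin; destruct (Rle_dec rho x), (Rle_dec rho y); unfold Rmax;
      repeat match goal with |- context [Rle_dec ?a ?b] => destruct (Rle_dec a b) end;
      unfold Rabs;
      repeat match goal with |- context [Rcase_abs ?a] => destruct (Rcase_abs a) end; lra. }
  intros e He; destruct (Hq (s r) (Hs r) e He) as (h & Hh & H).
  exists h; split; auto.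
  intros y [_ Hy]; simpl in *; unfold Rdist in *.
  change (Rabs (q (s y) - q (s r)) < e).
  destruct (Req_dec (s y) (s r)) as [->|ne].
  - now rewrite Rminus_diag, Rabs_R0.
  - apply H; split; [split; auto|].
    apply Rle_lt_trans with (2 := Hy), Hlip.
Qed.

Lemma continuity_bounded (f : R -> R) (a b : R) : a <= b -> continuity f ->
  exists B, 0 < B /\ forall x, a <= x <= b -> Rabs (f x) <= B.
Proof.
  intros ab Hf.
  destruct (continuity_ab_maj (fun x => Rabs (f x)) a b ab) as (m & Hm & _).
  { intros x _; apply (continuity_pt_comp f Rabs); [apply Hf|apply Rcontinuity_abs]. }
  exists (Rabs (f m) + 1); split; [pose proof (Rabs_pos (f m)); lra|].
  intros x Hx; specialize (Hm x Hx); lra.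
Qed.

Lemma positive_at_interior_point (f : R -> R) (rho r0 : R) :
  continuity f -> 0 < rho -> 0 <= r0 <= rho -> 0 < f r0 ->
  exists a, 0 < a < rho /\ 0 < f a.
Proof.
  intros Hf Hrho Hr0 Hpos.
  assert (Hc := Hf r0); rewrite continuity_pt_locally in Hc.
  destruct (Hc (mkposreal _ Hpos)) as [h Hh]; simpl in Hh.
  assert (Hm : 0 < Rmin h rho / 4).
  { assert (0 < Rmin h rho) by (apply Rmin_glb_lt; [apply cond_pos|lra]). lra. }
  pose proof (Rmin_l h rho); pose proof (Rmin_r h rho).
  assert (Hnear : forall a, Rabs (a - r0) = Rmin h rho / 4 -> 0 < f a).
  { intros a E; specialize (Hh a).
    assert (Hlt : Rabs (f a - f r0) < f r0).
    { apply Hh; change (Rabs (a - r0) < h); lra. }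
    apply Rabs_def2 in Hlt; lra. }
  destruct (Rle_dec r0 (rho / 2)) as [Hle|Hle].
  - exists (r0 + Rmin h rho / 4); split; [lra|]; apply Hnear.
    rewrite Rabs_right; lra.
  - exists (r0 - Rmin h rho / 4); split; [lra|]; apply Hnear.
    rewrite Rabs_left; lra.
Qed.

Theorem theorem1p1 (N : nat) (hN : (2 <= N)%nat) (rho : R) (hrho : 0 < rho)
    (p : R) (hp : 1 < p) (q : R -> R) (hq : continuous_on_Icc 0 rho q)
    (hqpos : exists r0, Icc 0 rho r0 /\ 0 < q r0) :
  forall k : nat, (1 <= k)%nat ->
  exists lambda_star : R, 0 < lambda_star /\
  forall lambda : R, lambda_star < lambda ->
  exists U : nat -> Vector.t R N -> R,
    (forall i, (i < 4 * k)%nat ->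
       radial_solution N rho p q lambda (U i) /\ nodal rho (U i)) /\
    (forall i j, (i < 4 * k)%nat -> (j < 4 * k)%nat -> i <> j ->
       exists x, closed_ball rho x /\ U i x <> U j x).
Proof.
  intros k Hk; pose proof PI_RGT_0 as HPI.
  set (n := (N - 1)%nat).
  assert (n_pos : (1 <= n)%nat) by (unfold n; lia).
  set (qe := fun r => q (Rmax 0 (Rmin rho r))).
  assert (qe_cont : continuity qe) by now apply continuity_clamped.
  assert (qe_eq : forall r, 0 <= r <= rho -> qe r = q r).
  { intros r Hr; unfold qe; now rewrite Rmin_right, Rmax_right by lra. }
  destruct (continuity_bounded qe 0 rho ltac:(lra) qe_cont) as (Q & PQ & HQ).
  assert (qe_bound : forall r, Rabs (qe r) <= Q).
  { intros r.
    assert (Hs : 0 <= Rmax 0 (Rmin rho r) <= rho).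
    { split; [apply Rmax_l|]; apply Rmax_lub; [lra|apply Rmin_l]. }
    specialize (HQ _ Hs); now rewrite qe_eq in HQ. }
  destruct hqpos as (r0 & Hr0 & Hq0).
  destruct (positive_at_interior_point qe rho r0 qe_cont hrho Hr0) as (a & Ha & Hqa).
  { now rewrite qe_eq. }
  pose proof (weight_pos n a (proj1 Ha)) as Wa.
  set (kappa := weight n a * qe a).
  assert (Pk : 0 < kappa) by now apply Rmult_lt_0_compat.
  set (P := (p + 1) / kappa).
  assert (PP : 0 < P) by (apply Rdiv_lt_0_compat; lra).
  set (rate := turning_rate p (weight n a) kappa).
  assert (Prate : 0 < rate).
  { unfold rate, turning_rate; apply Rdiv_lt_0_compat; [lra|].
    fold P; pose proof (pow2_ge_0 (weight n a + 2)); lra. }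
  set (T := INR (S k) * PI / rate).
  assert (PT : 0 < T).
  { apply Rdiv_lt_0_compat; auto; apply Rmult_lt_0_compat; auto.
    apply lt_0_INR; lia. }
  assert (PD : 0 < 5 * T * ((kappa + 1) * (1 + P))).
  { apply Rmult_lt_0_compat; [lra|]; apply Rmult_lt_0_compat; lra. }
  (* The angle is to gain [(k + 1) * PI] over [[a, a + T / mu]]; [eta] is the
     variation of the coefficients that keeps the energy drift below [1 / 5]. *)
  set (eta := Rmin (Rmin (1 / 2) (kappa / 2)) (/ (5 * T * ((kappa + 1) * (1 + P))))).
  assert (Heta : 0 < eta /\ eta <= 1 / 2 /\ eta <= kappa / 2
    /\ eta <= / (5 * T * ((kappa + 1) * (1 + P)))).
  { unfold eta; set (e3 := / _).
    assert (0 < e3) by now apply Rinv_0_lt_compat.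
    pose proof (Rmin_l (Rmin (1 / 2) (kappa / 2)) e3).
    pose proof (Rmin_r (Rmin (1 / 2) (kappa / 2)) e3).
    pose proof (Rmin_l (1 / 2) (kappa / 2)); pose proof (Rmin_r (1 / 2) (kappa / 2)).
    split; [|lra]; repeat apply Rmin_glb_lt; lra. }
  destruct Heta as (He0 & He1 & He2 & He3).
  assert (Hwc := weight_continuity n a).
  assert (Hwqc : continuity_pt (fun t => weight n t * qe t) a).
  { apply (continuity_pt_mult (weight n) qe); [apply weight_continuity|apply qe_cont]. }
  rewrite continuity_pt_locally in Hwc, Hwqc.
  destruct (Hwc (mkposreal _ (Rmult_lt_0_compat _ _ He0 Wa))) as [h1 Hh1].
  destruct (Hwqc (mkposreal _ He0)) as [h2 Hh2].
  simpl in Hh1, Hh2.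
  set (h := Rmin (Rmin h1 h2) (rho - a)).
  assert (Hh : 0 < h /\ h <= h1 /\ h <= h2 /\ h <= rho - a).
  { unfold h; pose proof (cond_pos h1); pose proof (cond_pos h2).
    pose proof (Rmin_l (Rmin h1 h2) (rho - a)); pose proof (Rmin_r (Rmin h1 h2) (rho - a)).
    pose proof (Rmin_l h1 h2); pose proof (Rmin_r h1 h2).
    split; [|lra]; repeat apply Rmin_glb_lt; lra. }
  destruct Hh as (Ph & Hhh1 & Hhh2 & Hhr).
  (* The first term places [a + T / mu] within [h] of [a]; the second gives the
     solution of amplitude [rho] energy at least [1] at [a]. *)
  set (mu_star := T / h + (1 + P) / (rho - a)).
  assert (PTh : 0 < T / h) by now apply Rdiv_lt_0_compat.
  assert (PPr : 0 < (1 + P) / (rho - a)) by (apply Rdiv_lt_0_compat; lra).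
  assert (Pms : 0 < mu_star) by (unfold mu_star; lra).
  exists (Rpower mu_star (p + 1)); split; [apply exp_pos|].
  intros lam Hlam.
  assert (Plam : 0 < lam).
  { pose proof (exp_pos ((p + 1) * ln mu_star)); unfold Rpower in Hlam; lra. }
  set (mu := Rpower lam (/ (p + 1))).
  assert (mu_pos : 0 < mu) by apply exp_pos.
  assert (Hmu_lam : Rpower mu (p + 1) = lam).
  { unfold mu; rewrite Rpower_mult, Rinv_l, Rpower_1; lra. }
  assert (Hmu : mu_star < mu).
  { replace mu_star with (Rpower (Rpower mu_star (p + 1)) (/ (p + 1))).
    - apply Rlt_Rpower_l; [apply Rinv_0_lt_compat; lra|split; [apply exp_pos|auto]].
    - rewrite Rpower_mult, Rinv_r, Rpower_1; lra. }
  set (b := a + T / mu).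
  assert (Hmub : mu * (b - a) = T) by (unfold b; field; lra).
  assert (Hb : a <= b < a + h).
  { unfold b; split.
    - assert (0 < T / mu) by now apply Rdiv_lt_0_compat. lra.
    - apply Rplus_lt_compat_l, Rmult_lt_reg_r with (mu / h).
      + now apply Rdiv_lt_0_compat.
      + replace (T / mu * (mu / h)) with (T / h) by (field; lra).
        replace (h * (mu / h)) with mu by (field; lra). unfold mu_star in Hmu; lra. }
  (* For an amplitude in [[0, rho]], [|u| <= d + r <= 2 * rho]. *)
  set (c := fun r => lam * qe r).
  set (g := fun x => signed_pow p (clamp (2 * rho) x)).
  set (C := lam * Q); set (L := p * Rpower (2 * rho) (p - 1)).
  set (G := L * (2 * rho)); set (K := 1 + 2 * (C * L)).
  assert (PL : 0 < L).
  { apply Rmult_lt_0_compat; [lra|apply exp_pos]. }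
  assert (PC : 0 < C) by now apply Rmult_lt_0_compat.
  assert (c_cont : continuity c) by now apply (continuity_scal qe lam).
  assert (c_bound : forall r, Rabs (c r) <= C).
  { intros r; unfold c; rewrite Rabs_mult, (Rabs_right lam) by lra.
    apply Rmult_le_compat_l; auto; lra. }
  assert (g_lip : forall x y, Rabs (g x - g y) <= L * Rabs (x - y)).
  { intros x y; apply Rle_trans with (L * Rabs (clamp (2 * rho) x - clamp (2 * rho) y)).
    - apply signed_pow_lipschitz; auto; try lra; apply clamp_abs_le; lra.
    - apply Rmult_le_compat_l; [lra|apply clamp_lipschitz]. }
  assert (g_0 : g 0 = 0).
  { unfold g; rewrite clamp_id; [apply signed_pow_0|rewrite Rabs_R0; lra]. }
  assert (g_bound : forall x, Rabs (g x) <= G).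
  { intros x; unfold g.
    rewrite <- (Rminus_0_r (signed_pow p _)), <- (signed_pow_0 p).
    apply Rle_trans with (L * Rabs (clamp (2 * rho) x - 0)).
    - apply signed_pow_lipschitz; auto; try lra; [apply clamp_abs_le; lra|].
      rewrite Rabs_R0; lra.
    - rewrite Rminus_0_r; apply Rmult_le_compat_l; [lra|apply clamp_abs_le; lra]. }
  assert (CL : 0 < C * L) by now apply Rmult_lt_0_compat.
  assert (K_ge1 : 1 <= K) by (unfold K; lra).
  assert (K_large : 2 * (C * L) <= K ^ 2).
  { unfold K; clear - CL; nra. }
  set (u := solution n c g).
  assert (Hg_u : forall d t, 0 <= d <= rho -> 0 <= t <= rho ->
    g (u d t) = signed_pow p (u d t)).
  { intros d t Hd Ht; unfold g; rewrite clamp_id; auto.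
    apply Rle_trans with (d + t); [|lra].
    apply (solution_abs_le n n_pos c g C G L K); auto; lra. }
  assert (Hturn : exists ds, 0 < ds <= rho /\ INR k * PI + PI / 2 < angle n c g mu ds rho).
  { apply (amplitude_with_many_turns n n_pos c g C G L K) with p qe a b eta; auto;
      fold kappa; fold P; try lra.
    - intros d t Hd Ht; fold u; rewrite Hg_u, signed_pow_scale by auto.
      unfold c; rewrite <- Hmu_lam, Rpower_plus, Rpower_1 by auto; ring.
    - intros t Ht; specialize (Hh1 t ltac:(change (Rabs (t - a) < h1);
        apply Rabs_def1; lra)).
      apply Rabs_def2 in Hh1; lra.
    - intros t Ht; specialize (Hh2 t ltac:(change (Rabs (t - a) < h2);
        apply Rabs_def1; lra)).
      unfold kappa; lra.
    - apply Rle_trans with ((1 + P) / (rho - a) * (rho - a)).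
      + right; field; lra.
      + apply Rmult_le_compat_r; [lra|]; unfold mu_star in Hmu; lra.
    - rewrite Hmub.
      apply Rle_trans with (T * ((kappa + 1) * / (5 * T * ((kappa + 1) * (1 + P))) * (1 + P))).
      + apply Rmult_le_compat_l; [lra|]; apply Rmult_le_compat_r; [lra|].
        apply Rmult_le_compat_l; lra.
      + right; field; lra.
    - rewrite Hmub; fold rate; right; unfold T; field; lra. }
  destruct Hturn as (ds & Hds & Hturn).
  assert (Hg_small : forall e, 0 < e -> exists delta, 0 < delta /\
    forall x, Rabs x <= delta -> Rabs (g x) <= e * Rabs x).
  { intros e He; destruct (signed_pow_small p hp e He) as (delta & Pd & Hd).
    exists (Rmin delta (2 * rho)); split; [apply Rmin_glb_lt; lra|].
    intros x Hx; pose proof (Rmin_l delta (2 * rho)); pose proof (Rmin_r delta (2 * rho)).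
    unfold g; rewrite clamp_id by lra; apply Hd; lra. }
  destruct (many_amplitudes n n_pos c g C G L K c_cont c_bound g_lip g_0 g_bound
    K_ge1 K_large mu mu_pos rho ds k hrho Hds Hg_small Hturn) as (D & HD & Dinj).
  fold u in HD.
  (* The indices [2 i] and [2 i + 1] carry opposite solutions. *)
  set (sign := fun i => if Nat.even i then 1 else -1).
  assert (Hsign : forall i, sign i = 1 \/ sign i = -1).
  { intros i; unfold sign; destruct (Nat.even i); auto. }
  assert (Hhalf : forall i, (i < 4 * k)%nat -> (i / 2 < 2 * k)%nat).
  { intros i Hi; apply Nat.Div0.div_lt_upper_bound; lia. }
  assert (Hu0 : forall d, u d 0 = d).
  { intros d; apply (solution_at_0 n n_pos c g C G L K); auto. }
  exists (fun i x => sign i * u (D (i / 2)%nat) (enorm x)).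
  split.
  - intros i Hi; destruct (HD (i / 2)%nat (Hhalf i Hi)) as (Hd & Hend & s & Hs & Hneg).
    split.
    + exists (fun r => sign i * u (D (i / 2)%nat) r); split; auto.
      apply (solution_profile n n_pos c g C G L K); auto; try lra.
      intros r Hr; fold u; rewrite Hg_u by lra; unfold c; now rewrite qe_eq.
    + destruct (point_of_norm N 0 ltac:(lia) ltac:(lra)) as (x0 & Hx0).
      destruct (point_of_norm N s ltac:(lia) ltac:(lra)) as (xs & Hxs).
      unfold nodal, closed_ball; destruct (Hsign i) as [->| ->].
      * exists xs, x0; rewrite Hx0, Hxs, Hu0; repeat split; lra.
      * exists x0, xs; rewrite Hx0, Hxs, Hu0; repeat split; lra.
  - intros i j Hi Hj Hij.
    destruct (point_of_norm N 0 ltac:(lia) ltac:(lra)) as (x0 & Hx0).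
    exists x0; unfold closed_ball; rewrite Hx0, !Hu0; split; [lra|].
    destruct (HD (i / 2)%nat (Hhalf i Hi)) as (Hdi & _).
    destruct (HD (j / 2)%nat (Hhalf j Hj)) as (Hdj & _).
    unfold sign; intros E.
    pose proof (Nat.div_mod_eq i 2) as Ei; pose proof (Nat.div_mod_eq j 2) as Ej.
    assert (Hmod : Nat.even i = Nat.even j).
    { destruct (Nat.even i), (Nat.even j); auto; lra. }
    apply Hij; rewrite Ei, Ej; f_equal.
    + f_equal; apply Dinj; auto.
      rewrite Hmod in E; destruct (Nat.even j); lra.
    + pose proof (Nat.bit0_mod i) as Bi; pose proof (Nat.bit0_mod j) as Bj.
      rewrite Nat.bit0_odd in Bi, Bj; unfold Nat.odd in Bi, Bj.
      rewrite Hmod in Bi; now rewrite <- Bi, <- Bj.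
Qed.
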